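(* Let $M$ be a communicating MDP with $|S|$ states, $|A|$ actions and diameter $D$, and suppose that $M$ has a state $s^*$ and an action $a$ such that $\Pr(s_{t+1}=s^*\mid s_t=s^*,a_t=a)=1$. Then the regret of the algorithm $\mathcal{A}_3$ described in the context (FPL over the stationary deterministic policies combined with the Switch\_Policy routine) can be bounded by $$\text{Regret}\le O\left(D^2\sqrt{T|S|\log|A|}\right).$$
   Context: **MDP.** $M$ has a finite state space $S$, a finite action space $A$ and transition probabilities $P(s,a,s')$, known to the learner. A stationary policy is a map $\pi:S\times A\to[0,1]$ with $\pi(s,a)$ the probability of taking action $a$ in state $s$; it is deterministic if it always takes one action in each state. $T(s'\mid M,\pi,s)$ is the random first time step at which $s'$ is reached when starting at $s$ and following $\pi$ in $M$. The diameter is $D=D(M)=\max_{s\ne s'}\min_\pi\mathbb{E}[T(s'\mid M,\pi,s)]$, and $M$ is communicating if $D(M)<\infty$. **Protocol.** An oblivious adversary fixes in advance loss functions $\ell_1,\dots,\ell_T:S\times A\to[0,1]$. The start state is $s_1\sim d_1$. At each step $t=1,\dots,T$ the learner in state $s_t$ chooses $a_t$, incurs $\ell_t(s_t,a_t)$, then the whole function $\ell_t$ is revealed (full information), and $s_{t+1}\sim P(s_t,a_t,\cdot)$. For a stationary policy $\pi$, $\hat\ell_t(\pi)=\mathbb{E}[\ell_t(s_t,a_t)]$ when $\pi$ is followed from the start ($s_1\sim d_1$), $L^\pi=\sum_{t=1}^T\hat\ell_t(\pi)$, and $d_\pi^t$ is the distribution of the state at time $t$ when $\pi$ is followed from the start.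 The regret of an algorithm is $\mathbb{E}[\sum_{t=1}^T\ell_t(s_t,a_t)]-\min_{\pi\in\Pi}L^\pi$, where $\Pi$ is the set of stationary deterministic policies. **FPL.** The follow-the-perturbed-leader experts algorithm of Kalai and Vempala, run with each policy in $\Pi$ as an expert (the losses of each policy being perturbed independently); with $n$ experts it has regret and number of switches $O(\sqrt{T\log n})$. **Catching quantities.** There are a number $\ell^*\le 2D$ and, for every target state $s'$, a (possibly non-stationary) policy $\pi_{s'}$ with $p_{s'}=\Pr[T(s'\mid M,\pi_{s'},s^* )=\ell^*]\ge\frac1{4D}$; these are fixed, and $p^*=\min_s p_s$. **Switch\_Policy** (target policy $\pi$, from the current state; $S_t$ is the state at time $t$). Repeat: (i) move to $s^*$ using the best policy (the one minimizing the expected time to reach $s^*$); let $t$ be the time of arrival. (ii) Sample a target state $T_{t+\ell^*}$ from $d_\pi^{t+\ell^*}$, use $\pi_{T_{t+\ell^*}}$ to move $\ell^*$ steps from $s^*$, and replace $t$ by $t+\ell^*$. (iii) If $S_t=T_t$, draw a Bernoulli variable $I$ with $\Pr[I=1]=p^*/p_{S_t}$; if $I=1$, terminate and start following $\pi$. Otherwise go back to (i). **Algorithm $\mathcal{A}_3$.** Start by following the policy chosen by FPL at time 1. After each step compute $\hat\ell_t$ from the revealed $\ell_t$ and feed it to FPL. If FPL switches policy, call Switch\_Policy with the new FPL policy as target, and then follow that policy; otherwise keep following the current policy. If FPL switches again in the middle of an execution of Switch\_Policy, that execution is terminated and the routine is called again with the new target policy.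
   Formalization: The catching probability p_{s'} is taken as the probability of being in s' after ℓ* steps, not of first reaching s' at time ℓ* (impossible for s' = s*, and giving a wrong law at termination if s' is revisited); |S| ≥ 2 is assumed so that the diameter is defined. *)

(* Defs.v *)
From HB Require Import structures.
From mathcomp Require Import all_boot all_order all_algebra.
From mathcomp Require Import all_classical all_reals all_analysis.

Set Implicit Arguments.
Unset Strict Implicit.
Unset Printing Implicit Defensive.

Import Order.TTheory GRing.Theory Num.Theory.

Local Open Scope ring_scope.

Record fdist (R : realType) (X : finType) := FDist {
  fd_pmf :> X -> R;
  fd_ge0 : forall x, 0 <= fd_pmf x;
  fd_sum1 : \sum_x fd_pmf x = 1 }.

Definition point_mass (R : realType) (X : eqType) (x : X) : X -> R :=
  fun y => (y == x)%:R.

Lemma point_ge0 (R : realType) (X : finType) (x y : X) : 0 <= point_mass R x y.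
Proof. exact: ler0n. Qed.

Lemma point_sum1 (R : realType) (X : finType) (x : X) :
  \sum_y point_mass R x y = 1.
Proof.
rewrite (bigD1 x) //= /point_mass eqxx big1 ?addr0 // => y /negbTE -> //.
Qed.

Definition fd_point (R : realType) (X : finType) (x : X) : fdist R X :=
  FDist (point_ge0 R x) (point_sum1 R x).

Section MDP.
Variables (R : realType) (S A : finType).

Definition mdp := S -> A -> fdist R S.

Definition policy := S -> fdist R A.
Definition nspolicy := nat -> policy.
Definition detpolicy := {ffun S -> A}.

Definition of_det (pi : detpolicy) : policy := fun s => fd_point R (pi s).

Variable M : mdp.

Definition step (mu : policy) (s u : S) : R := \sum_a mu s a * M s a u.

(* Probability that, started in s, the next states are those listed in x. *)
Fixpoint path_prob (mu : policy) (s : S) (x : seq S) : R :=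
  if x is u :: x' then step mu s u * path_prob mu u x' else 1.

(* Law of T(s' | M, mu, s): the first index at which s' occurs in the
   trajectory s :: x is k. *)
Definition hit_prob (mu : policy) (s s' : S) (k : nat) : R :=
  \sum_(x : k.-tuple S | index s' (s :: x) == k) path_prob mu s x.

(* E[T(s' | M, mu, s)]; the last term is the contribution of the event that s'
   is never reached (with +oo * 0 = 0). *)
Definition expected_hit (mu : policy) (s s' : S) : \bar R :=
  (\sum_(0 <= k <oo) (k%:R * hit_prob mu s s' k)%:E
   + +oo * (1 - \sum_(0 <= k <oo) (hit_prob mu s s' k)%:E))%E.

Definition best_hit (s s' : S) : \bar R :=
  ereal_inf (range (fun mu : policy => expected_hit mu s s')).

Definition diameter : \bar R :=
  \big[maxe/-oo%E]_(p : S * S | p.1 != p.2) best_hit p.1 p.2.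

Definition communicating : Prop := (diameter < +oo)%E.

Definition diam : R := fine diameter.

Definition best_policy_to (s' : S) (mu : policy) : Prop :=
  forall s, expected_hit mu s s' = best_hit s s'.

(* Law of the state after t steps. *)
Fixpoint state_law (d : S -> R) (mu : nspolicy) (t : nat) : S -> R :=
  if t is t'.+1
  then fun u => \sum_s state_law d mu t' s * step (mu t') s u
  else d.

(* Catching quantities: l steps of catch s', started at sstar, end in s' with
   probability catch_prob s'. This includes s' = sstar, for which a hitting
   time counted from 0 would be useless; and it is the probability of the
   event tested when the l steps are over, even if s' was also visited
   earlier. *)
Definition catch_prob (sstar : S) (l : nat) (catch : S -> nspolicy) (s' : S)
    : R :=
  state_law (point_mass R sstar) (catch s') l s'.

Definition catching (sstar : S) (l : nat) (catch : S -> nspolicy) : Prop :=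
  l%:R <= 2 * diam /\
  forall s', 1 / (4 * diam) <= catch_prob sstar l catch s'.

Definition min_catch_prob (sstar : S) (l : nat) (catch : S -> nspolicy) : R :=
  \big[Num.min/1]_(s : S) catch_prob sstar l catch s.

End MDP.

(* Time is counted from 0: the losses are ell 0, ..., ell (T - 1) and the
   initial state has law d1. *)
Section Losses.
Variables (R : realType) (S A : finType) (M : mdp R S A) (d1 : fdist R S).
Variables (T : nat) (ell : nat -> S -> A -> R).

(* d_pi^t *)
Definition occupation (pi : detpolicy S A) (t : nat) : S -> R :=
  state_law M d1 (fun=> of_det R pi) t.

Definition hat_loss (t : nat) (pi : detpolicy S A) : R :=
  \sum_s occupation pi t s * \sum_a of_det R pi s a * ell t s a.

Definition policy_loss (pi : detpolicy S A) : R :=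
  \sum_(t < T) hat_loss t pi.

Definition fpl_rate : R :=
  Num.sqrt (ln #|{: detpolicy S A}|%:R / T%:R).

(* Follow the perturbed leader with expert set detpolicy S A. The perturbation
   noise pi is drawn once, from the exponential law of rate 1, so that
   noise pi / fpl_rate is exponential of rate fpl_rate. The policy played at
   time t depends on the losses before t only. a0 is only the seed required by
   arg min; it does not affect the minimum. *)
Definition fpl (a0 : A) (noise : detpolicy S A -> R) (t : nat)
    : detpolicy S A :=
  [arg min_(pi < [ffun=> a0] : detpolicy S A)
     (\sum_(i < t) hat_loss i pi - noise pi / fpl_rate)]%O.

End Losses.

(* What the learner is doing: following the FPL policy; moving to sstar;
   chasing a target from sstar, k steps of the chase being done. *)
Inductive mode (S : finType) (l : nat) :=
  | Follow
  | Move
  | Catch of S & 'I_l.+1.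

Arguments Follow {S l}.
Arguments Move {S l}.

Section ModeFinite.
Variables (S : finType) (l : nat).

Definition mode_encode (m : mode S l) : bool + S * 'I_l.+1 :=
  match m with
  | Follow => inl true
  | Move => inl false
  | Catch s k => inr (s, k)
  end.

Definition mode_decode (c : bool + S * 'I_l.+1) : mode S l :=
  match c with
  | inl b => if b then Follow else Move
  | inr p => Catch p.1 p.2
  end.

Lemma mode_encodeK : cancel mode_encode mode_decode.
Proof. by case. Qed.

HB.instance Definition _ := Finite.copy (mode S l) (can_type mode_encodeK).

End ModeFinite.

Section Algorithm.
Variables (R : realType) (S A : finType) (M : mdp R S A) (d1 : fdist R S).
Variables (T : nat) (ell : nat -> S -> A -> R).
Variables (sstar : S) (goto : policy R S A).
Variables (l : nat) (catch : S -> nspolicy R S A).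

(* The adversary being oblivious, the FPL policies q 0, q 1, ... depend on the
   perturbations only. The definitions down to learner_loss describe the
   process conditionally on q. *)
Variable q : nat -> detpolicy S A.

(* Steps (i)-(ii), in state s at time t: keep moving while s != sstar, and
   otherwise draw a target. *)
Definition chase (t : nat) (s : S) : mode S l -> R := fun m =>
  if s == sstar
  then (if m is Catch s' k
        then (k == ord0)%:R * occupation M d1 (q t) (t + l) s' else 0)
  else point_mass R Move m.

(* Step (iii) after a chase of target s' that ends in state s at time t. *)
Definition chase_end (t : nat) (s s' : S) : mode S l -> R := fun m =>
  if s == s'
  then let r := min_catch_prob M sstar l catch / catch_prob M sstar l catch s in
       r * point_mass R Follow m + (1 - r) * chase t s m
  else chase t s m.

(* Law of the mode in which the learner acts at time t.+1 in state s, when it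
   arrives there in mode m. A switch of FPL aborts everything else. *)
Definition update_mode (t : nat) (m : mode S l) (s : S) : mode S l -> R :=
  if q t.+1 != q t then chase t.+1 s else
  match m with
  | Follow => point_mass R Follow
  | Move => chase t.+1 s
  | Catch s' k => if (k < l)%N then point_mass R m else chase_end t.+1 s s'
  end.

Definition act (t : nat) (m : mode S l) : policy R S A :=
  match m with
  | Follow => of_det R (q t)
  | Move => goto
  | Catch s' k => catch s' k
  end.

Definition next_mode (m : mode S l) : mode S l :=
  if m is Catch s' k then Catch s' (inord k.+1) else m.

(* Joint law of the state at time t and of the mode in which the learner
   acts. *)
Fixpoint config_law (t : nat) : S * mode S l -> R :=
  if t is t'.+1
  then fun c => \sum_c' config_law t' c' *
         (step M (act t' c'.2) c'.1 c.1 *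
          update_mode t' (next_mode c'.2) c.1 c.2)
  else fun c => d1 c.1 * point_mass R Follow c.2.

Definition learner_loss : R :=
  \sum_(t < T) \sum_c config_law t c *
    \sum_a act t c.2 c.1 a * ell t c.1 a.

End Algorithm.

Definition mutually_independent (R : realType) (I : finType)
    (d : measure_display) (Omega : measurableType d) (P : probability Omega R)
    (X : I -> {RV P >-> R}) : Prop :=
  forall B : I -> set R, (forall i, measurable (B i)) ->
    P (\bigcap_i (X i @^-1` B i))%classic = (\prod_i P (X i @^-1` B i)%classic)%E.

Definition exponential_noise (R : realType) (I : finType)
    (d : measure_display) (Omega : measurableType d) (P : probability Omega R)
    (X : I -> {RV P >-> R}) : Prop :=
  mutually_independent X /\
  forall i (B : set R), measurable B ->
    distribution P (X i) B = exponential_prob 1 B.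

(* X is the FPL perturbation; the range of policy_loss is finite, so that inf
   is a minimum. *)
Definition regret (R : realType) (S A : finType) (M : mdp R S A)
    (d1 : fdist R S) (T : nat) (ell : nat -> S -> A -> R)
    (sstar : S) (a0 : A) (goto : policy R S A)
    (l : nat) (catch : S -> nspolicy R S A)
    (d : measure_display) (Omega : measurableType d) (P : probability Omega R)
    (X : detpolicy S A -> {RV P >-> R}) : R :=
  \int[P]_w learner_loss M d1 T ell sstar goto l catch
    (fpl M d1 T ell a0 (fun pi => X pi w))
  - inf (range (policy_loss M d1 T ell)).

(* Main.v *)
(* Fix the sequence q of leaders first. The Bernoulli draw of step (iii) makes
   every target state equally easy to catch, so that, conditionally on the
   learner following q t at time t, its state has the law of the state at time t
   of q t followed from the start: its expected loss is then hat_loss t (q t).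
   One attempt of Switch_Policy takes D steps to reach sstar and l <= 2 D steps
   to chase, and succeeds with probability at least 1 / (4 D); a potential
   function turns this into an expected cost of at most D + 12 D ^ 2 per switch
   of q. It remains to bound the loss of the leaders and their number of
   switches. The former is the be-the-leader lemma; the latter is the memoryless
   property of the exponential law, by which a leader keeps leading after a
   round with probability at least exp (- 2 eta). *)
From HB Require Import structures.
Require Import Defs.
From mathcomp Require Import all_boot all_order all_algebra.
From mathcomp Require Import finmap.
From mathcomp Require Import all_classical all_reals all_analysis.
From mathcomp Require Import measurable_realfun.
From mathcomp Require Import ring lra.

Set Implicit Arguments.
Unset Strict Implicit.
Unset Printing Implicit Defensive.

Import Order.TTheory GRing.Theory Num.Theory.

Local Open Scope ring_scope.

(** On the learner's side the obstacle is a product form: the law of the state in mode [Follow]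
    requires the joint law of state and target during a chase, with a scalar factor common to all
    targets. Retries and aborted executions only alter that scalar, so their history need not be
    tracked. Away from [Follow] no law is computed; each step is charged the maximal loss 1. On the
    noise side, the largest of N exponential variables has size about [ln N] but is unbounded, so
    expectations are replaced by finite sums of probabilities of half-lines and of switches. The
    noise costs about [ln N / eta] and the switches about [D ^ 2 * eta * T]. The choice of
    [fpl_rate] equates [ln N / eta] with [eta * T] and does not involve D, so the cost [D ^ 2] of
    one switch reaches the final bound unchanged. *)

Section Laws.
Variables (R : realType) (S A : finType) (M : mdp R S A).
Implicit Types (mu : policy R S A) (f : S -> R).

Lemma step_ge0 mu s u : 0 <= step M mu s u.
Proof. by apply: sumr_ge0 => a _; rewrite mulr_ge0 ?fd_ge0. Qed.

Lemma step_sum1 mu s : \sum_u step M mu s u = 1.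
Proof.
rewrite exchange_big /= -[RHS](fd_sum1 (mu s)).
by apply: eq_bigr => a _; rewrite -mulr_sumr fd_sum1 mulr1.
Qed.

Lemma step_avg_le mu s f c : (forall u, f u <= c) ->
  \sum_u step M mu s u * f u <= c.
Proof.
move=> fc; rewrite -[leRHS]mul1r -(step_sum1 mu s) mulr_suml.
by apply: ler_sum => u _; rewrite ler_wpM2l ?step_ge0.
Qed.

Lemma step_avg_cst mu s c : \sum_u step M mu s u * c = c.
Proof. by rewrite -mulr_suml step_sum1 mul1r. Qed.

Lemma state_law_ge0 (d : S -> R) (nu : nspolicy R S A) t s :
  (forall s, 0 <= d s) -> 0 <= state_law M d nu t s.
Proof.
move=> d0; elim: t s => [|t IH] s //=.
by apply: sumr_ge0 => u _; rewrite mulr_ge0 ?step_ge0.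
Qed.

Lemma state_law_sum1 (d : S -> R) (nu : nspolicy R S A) t :
  \sum_s d s = 1 -> \sum_s state_law M d nu t s = 1.
Proof.
move=> d1; elim: t => [|t IH] //=.
rewrite exchange_big /= -[RHS]IH.
by apply: eq_bigr => s _; rewrite -mulr_sumr step_sum1 mulr1.
Qed.

End Laws.
(** * The learner for fixed FPL policies *)

Lemma sum_pair (R : nmodType) (I J : finType) (G : I * J -> R) :
  \sum_c G c = \sum_i \sum_j G (i, j).
Proof. by rewrite pair_bigA /=; apply: eq_bigr => -[]. Qed.

Section Process.
Variables (R : realType) (S A : finType) (M : mdp R S A) (d1 : fdist R S).
Variables (sstar : S) (goto : policy R S A) (l : nat).
Variables (catch : S -> nspolicy R S A) (q : nat -> detpolicy S A).

Lemma mode_decodeK : cancel (@mode_decode S l) (@mode_encode S l).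
Proof. by case=> [[]|[]]. Qed.

Lemma sum_mode (F : mode S l -> R) :
  \sum_m F m = F Follow + F Move + \sum_s \sum_k F (Catch s k).
Proof.
rewrite (reindex (@mode_decode S l)) /=; last first.
  by exists (@mode_encode S l) => m _; [exact: mode_decodeK|exact: mode_encodeK].
rewrite big_sumType /= big_bool /=; congr (_ + _).
by rewrite pair_big /=; apply: eq_bigr => -[].
Qed.

Let occ := occupation M d1.
Let cp := catch_prob M sstar l catch.
Let pmin := min_catch_prob M sstar l catch.
Let config : nat -> S * mode S l -> R := config_law M d1 sstar goto catch q.
Let upd : nat -> mode S l -> S -> mode S l -> R := update_mode M d1 sstar catch q.

Lemma occupation_ge0 pi t s : 0 <= occ pi t s.
Proof. by apply: state_law_ge0 => u; exact: fd_ge0. Qed.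

Lemma occupation_sum1 pi t : \sum_s occ pi t s = 1.
Proof. by apply: state_law_sum1; exact: fd_sum1. Qed.

Lemma catch_prob_ge0 s : 0 <= cp s.
Proof. by apply: state_law_ge0 => u; exact: point_ge0. Qed.

Lemma min_catch_prob_le s : pmin <= cp s.
Proof. by rewrite /pmin /min_catch_prob (bigD1 s) //= ge_min lexx. Qed.

Lemma chase_sum t s (F : mode S l -> R) :
  \sum_m chase M d1 sstar q t s m * F m =
  if s == sstar then \sum_s' occ (q t) (t + l) s' * F (Catch s' ord0)
  else F Move.
Proof.
rewrite sum_mode /chase; case: eqP => _.
  rewrite !mul0r !add0r; apply: eq_bigr => s' _.
  rewrite (bigD1 ord0) //= mul1r big1 ?addr0 // => k /negbTE ->.
  by rewrite !mul0r.
rewrite /point_mass eqxx mul1r mul0r add0r big1 ?addr0 // => s' _.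
by rewrite big1 // => k _; rewrite mul0r.
Qed.

Lemma point_mass_sum (m : mode S l) (F : mode S l -> R) :
  \sum_m' point_mass R m m' * F m' = F m.
Proof.
rewrite (bigD1 m) //= /point_mass eqxx mul1r big1 ?addr0 // => m' /negbTE ->.
by rewrite mul0r.
Qed.

Definition success_prob s := pmin / cp s.

Lemma chase_end_sum t s s' (F : mode S l -> R) :
  let c := \sum_m chase M d1 sstar q t s m * F m in
  \sum_m chase_end M d1 sstar catch q t s s' m * F m =
  if s == s' then success_prob s * F Follow + (1 - success_prob s) * c else c.
Proof.
rewrite /chase_end /=; case: eqP => // _.
under eq_bigr do rewrite mulrDl -!mulrA.
by rewrite big_split /= -!mulr_sumr point_mass_sum mulrA.
Qed.

Hypothesis pmin_gt0 : 0 < pmin.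

Lemma catch_prob_gt0 s : 0 < cp s.
Proof. exact: (lt_le_trans pmin_gt0 (min_catch_prob_le s)). Qed.

Lemma success_prob_ge0 s : 0 <= success_prob s.
Proof. by apply: divr_ge0; [exact: ltW|exact: catch_prob_ge0]. Qed.

Lemma success_prob_le1 s : success_prob s <= 1.
Proof. by rewrite ler_pdivrMr ?catch_prob_gt0 // mul1r min_catch_prob_le. Qed.

Lemma chase_ge0 t s (m : mode S l) : 0 <= chase M d1 sstar q t s m :> R.
Proof.
rewrite /chase; case: eqP => _; last exact: ler0n.
by case: m => // s' k; rewrite mulr_ge0 ?ler0n ?occupation_ge0.
Qed.

Lemma update_mode_ge0 t m s m' : 0 <= upd t m s m'.
Proof.
rewrite /upd /update_mode; case: ifP => _; first exact: chase_ge0.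
case: m => [||s' k]; [exact: ler0n|exact: chase_ge0|].
case: ifP => _; first exact: ler0n.
rewrite /chase_end; case: eqP => _; last exact: chase_ge0.
apply: addr_ge0; apply: mulr_ge0; rewrite ?ler0n ?chase_ge0 //.
  exact: success_prob_ge0.
by rewrite subr_ge0; exact: success_prob_le1.
Qed.

Lemma update_mode_sum1 t m s : \sum_m' upd t m s m' = 1.
Proof.
have chase1 t' s' : \sum_(m' : mode S l) chase M d1 sstar q t' s' m' = 1.
  under eq_bigr do rewrite -[chase _ _ _ _ _ _ _]mulr1.
  rewrite chase_sum; case: ifP => // _.
  by under eq_bigr do rewrite mulr1; exact: occupation_sum1.
have point1 (m0 : mode S l) : \sum_m' point_mass R m0 m' = 1.
  by under eq_bigr do rewrite -[point_mass _ _ _]mulr1; exact: point_mass_sum.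
rewrite /upd /update_mode; case: ifP => _ //; case: m => [||s' k] //.
case: ifP => _ //.
under eq_bigr do rewrite -[chase_end _ _ _ _ _ _ _ _ _]mulr1.
rewrite chase_end_sum; under eq_bigr do rewrite mulr1.
by rewrite chase1; case: eqP => // _; rewrite !mulr1 addrC subrK.
Qed.

Lemma config_ge0 t c : 0 <= config t c.
Proof.
elim: t c => [|t IH] c /=; first by rewrite mulr_ge0 ?fd_ge0 ?point_ge0.
by apply: sumr_ge0 => c' _; rewrite !mulr_ge0 ?step_ge0 ?update_mode_ge0.
Qed.

Lemma configS_sum t (V : S * mode S l -> R) :
  \sum_c config t.+1 c * V c =
  \sum_c' config t c' * \sum_u step M (act goto catch q t c'.2) c'.1 u *
     \sum_m upd t (next_mode c'.2) u m * V (u, m).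
Proof.
under eq_bigr do rewrite /= mulr_suml.
rewrite exchange_big /=; apply: eq_bigr => c' _.
under [in RHS]eq_bigr do rewrite mulr_sumr.
rewrite pair_big /= mulr_sumr; apply: eq_bigr => -[u m] _ /=.
by rewrite !mulrA.
Qed.

Lemma config_sum1 t : \sum_c config t c = 1.
Proof.
elim: t => [|t IH].
  rewrite sum_pair /= -[RHS](fd_sum1 d1).
  apply: eq_bigr => s _; rewrite -mulr_sumr.
  under eq_bigr do rewrite -[point_mass _ _ _]mulr1.
  by rewrite point_mass_sum mulr1.
under eq_bigr do rewrite -[config _ _]mulr1.
rewrite configS_sum -[RHS]IH; apply: eq_bigr => c _.
under eq_bigr => u _ do under eq_bigr do rewrite mulr1.
by under eq_bigr do rewrite update_mode_sum1 mulr1; rewrite step_sum1 mulr1.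
Qed.

Lemma configS t u m :
  config t.+1 (u, m) =
  \sum_m' \sum_s config t (s, m') *
    (step M (act goto catch q t m') s u * upd t (next_mode m') u m).
Proof.
rewrite exchange_big /= [RHS]pair_bigA /=.
by apply: eq_bigr => -[].
Qed.

Hypothesis l_gt0 : (0 < l)%N.

(** A chase whose last step is done is judged within the same update, so [ord_max] occurs only as an
    intermediate value of [next_mode]. With [l = 0] it would coincide with the fresh [ord0]. *)
Lemma update_mode_catch_max t m u s' : upd t m u (Catch s' ord_max) = 0.
Proof.
have chase0 t' u' : chase M d1 sstar q t' u' (Catch s' (ord_max : 'I_l.+1)) = 0.
  rewrite /chase; case: eqP => _ //.
  by rewrite -val_eqE /= eqn0Ngt l_gt0 mul0r.
rewrite /upd /update_mode; case: ifP => // _.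
case: m => [||s'' k] //.
case: ltnP => kl.
  by rewrite /point_mass; case: eqP kl => // -[_ <-]; rewrite ltnn.
rewrite /chase_end; case: ifP => // _.
by rewrite chase0 /point_mass /= !mulr0 addr0.
Qed.

Lemma config_catch_max t s s' : config t (s, Catch s' ord_max) = 0.
Proof.
case: t => [|t]; first by rewrite /= mulr0.
rewrite configS big1 // => m _; rewrite big1 // => u _.
by rewrite update_mode_catch_max !mulr0.
Qed.

(** Chance that the update made on arrival in [sstar], the only state where targets are drawn, draws
    a fresh one. After a chase of [sstar] itself, this is the chance that the Bernoulli draw
    fails. *)
Definition restart t (m : mode S l) : R :=
  if q t.+1 != q t then 1 else
  match m with
  | Follow => 0
  | Move => 1
  | Catch s' k => if (k < l)%N then 0 else 1 - (sstar == s')%:R * success_prob sstar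
  end.

(** The condition on [m] excludes a mode [Catch _ ord0] that merely persists, without any draw. *)
Lemma update_mode_catch0 t m u s' :
  (if m is Catch _ k then (0 < k)%N else true) ->
  upd t m u (Catch s' ord0) =
  restart t m * occ (q t.+1) (t.+1 + l) s' * point_mass R sstar u.
Proof.
have chE : chase M d1 sstar q t.+1 u (Catch s' (ord0 : 'I_l.+1)) =
    occ (q t.+1) (t.+1 + l) s' * point_mass R sstar u.
  rewrite /chase /point_mass.
  by case: (u == sstar); rewrite ?mul1r ?mulr1 ?mulr0.
move=> m0; rewrite /upd /update_mode /restart; case: ifP => _.
  by rewrite chE mul1r.
case: m m0 => [||s'' k] /= m0.
- by rewrite /point_mass /= !mul0r.
- by rewrite chE mul1r.
case: ltnP => kl.
  rewrite /point_mass; case: eqP m0 => [[_ <-] //|_ _].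
  by rewrite !mul0r.
rewrite /chase_end chE; case: (eqVneq u s'') => [<-|us].
  rewrite {2}/point_mass /= mulr0 add0r /success_prob.
  case: (eqVneq u sstar) => [->|/negbTE us]; last by rewrite /point_mass us !mulr0.
  by rewrite /point_mass eqxx !mulr1 mul1r.
case: (eqVneq u sstar) => [us2|/negbTE us2]; last by rewrite /point_mass us2 !mulr0.
by rewrite -us2 (negbTE us) mul0r subr0 mul1r.
Qed.

(** The target is drawn independently of the past, and the chase then runs from [sstar] by a policy
    that depends on the target only. What matters is that [al] depends on neither the state nor the
    target. *)
Lemma config_catch t (k : 'I_l.+1) : (k < l)%N ->
  exists al, forall s s', config t (s, Catch s' k) =
    al * occ (q t) (t + (l - k)) s' *
    state_law M (point_mass R sstar) (catch s') k s.
Proof.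
elim: t k => [|t IH] k kl.
  by exists 0 => s s'; rewrite !mul0r /= mulr0.
case: k kl => -[|j] jl1 kl.
  (* For [k = 0], [al] is the probability that a target is drawn at time [t.+1]. *)
  exists (\sum_m' \sum_s config t (s, m') *
    (step M (act goto catch q t m') s sstar * restart t (next_mode m'))) => u s'.
  have -> : state_law M (point_mass R sstar) (catch s') (Ordinal jl1) u =
      point_mass R sstar u by [].
  rewrite configS -mulrA mulr_suml; apply: eq_bigr => m' _.
  rewrite mulr_suml; apply: eq_bigr => s _.
  have [->|cn0] := eqVneq (config t (s, m')) 0; first by rewrite !mul0r.
  rewrite subn0 (_ : Ordinal jl1 = ord0); last exact: val_inj.
  rewrite update_mode_catch0; last first.
    case: m' cn0 => //= s'' k cn0.
    have kl1 : (k < l)%N.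
      rewrite ltn_neqAle -ltnS ltn_ord andbT; apply: contra cn0 => /eqP kE.
      by rewrite (_ : k = ord_max) ?config_catch_max //; exact: val_inj.
    by rewrite inordK ?ltnS.
  case: (eqVneq u sstar) => [->|/negbTE us]; first by rewrite !mulrA.
  by rewrite /point_mass us !mulr0.
have jl : (j < l)%N by exact: ltnW.
pose j' : 'I_l.+1 := Ordinal (ltnW jl1).
have [al alE] := IH j' jl.
case: (eqVneq (q t.+1) (q t)) => qq; last first.
  (* A switch leaves only chases with no step done, whereas here [k > 0]. *)
  exists 0 => u s'; rewrite configS !mul0r big1 // => m' _; rewrite big1 // => s _.
  rewrite /upd /update_mode qq /chase; case: eqP => _;
    last by rewrite /point_mass /= !mulr0.
  by rewrite /= mul0r !mulr0.
exists al => u s'; rewrite configS (bigD1 (Catch s' j')) //= [X in _ + X]big1 ?addr0.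
  rewrite qq (_ : (t.+1 + (l - j.+1)) = t + (l - j))%N; last first.
    by rewrite addSnnS -subSn // subSS.
  rewrite mulr_sumr; apply: eq_bigr => s _; rewrite alE /= !mulrA.
  rewrite -[RHS]mulr1; congr (_ * _).
  rewrite /upd /update_mode qq eqxx /= inordK // kl /point_mass.
  by rewrite (_ : Ordinal jl1 = inord j.+1) ?eqxx //; apply: val_inj; rewrite /= inordK.
move=> m' m'n; rewrite big1 // => s _.
have [->|cn0] := eqVneq (config t (s, m')) 0; first by rewrite !mul0r.
rewrite [upd _ _ _ _](_ : _ = 0) ?mulr0 //.
have ch0 : chase M d1 sstar q t.+1 u (Catch s' (Ordinal jl1)) = 0.
  by rewrite /chase; case: eqP => _ //=; rewrite mul0r.
rewrite /upd /update_mode qq eqxx /=.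
case: m' m'n cn0 => [||s'' k] m'n cn0 //=.
have kl1 : (k < l)%N.
  rewrite ltn_neqAle -ltnS ltn_ord andbT; apply: contra cn0 => /eqP kE.
  by rewrite (_ : k = ord_max) ?config_catch_max //; exact: val_inj.
rewrite inordK ?ltnS //; case: ltnP => kl2.
  rewrite /point_mass; case: eqP => // -[s's /(congr1 val)] /=.
  rewrite inordK ?ltnS // => -[kj].
  by case/eqP: m'n; rewrite s's; congr Catch; apply: val_inj.
rewrite /chase_end ch0; case: ifP => // _.
by rewrite /point_mass /= !mulr0 addr0.
Qed.

(* The catch probability of the target u is cancelled by success_prob u, which
   leaves the target distribution occupation (q t) t. *)
Lemma config_follow t : exists F, forall s, config t (s, Follow) = F * occ (q t) t s.
Proof.
elim: t => [|t [F FE]].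
  by exists 1 => s /=; rewrite mul1r /point_mass eqxx mulr1.
have ch0 u : chase M d1 sstar q t.+1 u (Follow : mode S l) = 0.
  by rewrite /chase; case: eqP.
case: (eqVneq (q t.+1) (q t)) => qq; last first.
  exists 0 => u; rewrite configS mul0r big1 // => m' _; rewrite big1 // => s _.
  by rewrite /upd /update_mode qq ch0 !mulr0.
have l1 : (l.-1 < l)%N by rewrite prednK.
pose k0 : 'I_l.+1 := Ordinal (ltnW l1 : (l.-1 < l.+1)%N).
have [al alE] := config_catch t (k := k0) l1.
(* Two sources feed [Follow]: the learner that already follows, and the chases on their last
   step. *)
exists (F + al * pmin) => u; rewrite configS sum_mode.
rewrite mulrDl; congr (_ + _).
  rewrite [X in _ + X]big1 ?addr0; last first.
    by move=> s _; rewrite /upd /update_mode qq eqxx /= ch0 !mulr0.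
  rewrite qq /occ /occupation /= mulr_sumr; apply: eq_bigr => s _.
  by rewrite FE /upd /update_mode qq eqxx /= /point_mass eqxx mulr1 -mulrA.
rewrite (bigD1 u) //= [X in _ + X]big1 ?addr0; last first.
  move=> s' s'u; rewrite big1 // => k _; rewrite big1 // => s _.
  rewrite [upd _ _ _ _](_ : _ = 0) ?mulr0 // /upd /update_mode qq eqxx /=.
  case: ltnP => _; first by rewrite /point_mass.
  by rewrite /chase_end eq_sym (negbTE s'u) ch0.
rewrite (bigD1 k0) //= [X in _ + X]big1 ?addr0; last first.
  move=> k kk0; rewrite big1 // => s _.
  have [->|cn0] := eqVneq (config t (s, Catch u k)) 0; first by rewrite !mul0r.
  have kl1 : (k < l)%N.
    rewrite ltn_neqAle -ltnS ltn_ord andbT; apply: contra cn0 => /eqP kE.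
    by rewrite (_ : k = ord_max) ?config_catch_max //; exact: val_inj.
  rewrite [upd _ _ _ _](_ : _ = 0) ?mulr0 // /upd /update_mode qq eqxx /=.
  rewrite inordK ?ltnS //; case: ltnP => kl2; first by rewrite /point_mass.
  case/eqP: kk0; apply: val_inj => /=; apply/eqP.
  by rewrite -eqSS prednK // eqn_leq kl1 kl2.
under eq_bigr => s _.
  rewrite [upd _ _ _ _](_ : _ = success_prob u); last first.
    rewrite /upd /update_mode qq eqxx /= inordK prednK // ltnn.
    by rewrite /chase_end eqxx ch0 mulr0 addr0 /point_mass eqxx mulr1.
  rewrite alE mulrA.
over.
rewrite -mulr_suml.
under eq_bigr do rewrite -mulrA.
rewrite -mulr_sumr qq /=.
have -> : (t + (l - l.-1) = t.+1)%N by rewrite -subn1 subKn // addn1.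
have -> : \sum_i state_law M (point_mass R sstar) (catch u) l.-1 i *
    step M (catch u l.-1) i u = cp u.
  transitivity (state_law M (point_mass R sstar) (catch u) l.-1.+1 u) => //.
  by rewrite prednK.
have sE : cp u * success_prob u = pmin.
  by rewrite /success_prob mulrCA mulfV ?mulr1 // gt_eqF // catch_prob_gt0.
by rewrite -mulrA sE -!mulrA [pmin * _]mulrC.
Qed.

Variables (h : S -> R) (D : R).
Hypotheses (h_ge0 : forall s, 0 <= h s) (h_le : forall s, h s <= D).
Hypothesis h_sstar : h sstar = 0.
Hypothesis h_step : forall s, s != sstar ->
  1 + \sum_u step M goto s u * h u <= h s.

(* Probability that a chase of s' that is in s with j steps left ends in s'. *)
Fixpoint reach (s' : S) (j : nat) (s : S) : R :=
  if j is j'.+1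
  then \sum_u step M (catch s' (l - j)%N) s u * reach s' j' u
  else point_mass R s' s.

Lemma reach_ge0 s' j s : 0 <= reach s' j s.
Proof.
elim: j s => [|j IH] s /=; first exact: point_ge0.
by apply: sumr_ge0 => u _; rewrite mulr_ge0 ?step_ge0.
Qed.

(** By the Markov property the sum does not depend on [j]. It is evaluated at [j = 0] and used at
    [j = l], where the chase starts. *)
Lemma reach_state_law s' j : (j <= l)%N ->
  \sum_s state_law M (point_mass R sstar) (catch s') (l - j) s * reach s' j s
  = cp s'.
Proof.
elim: j => [|j IH] jl.
  rewrite subn0 (bigD1 s') //= /point_mass eqxx mulr1 big1 ?addr0 // => s.
  by move=> /negbTE ->; rewrite mulr0.
rewrite -(IH (ltnW jl)) /=.
under eq_bigr do rewrite mulr_sumr.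
under [in RHS]eq_bigr do rewrite -[(l - j)%N](subnSK jl) /= mulr_suml.
rewrite exchange_big /=; apply: eq_bigr => u _; apply: eq_bigr => s _.
by rewrite mulrA.
Qed.

Lemma reach_sstar s' : reach s' l sstar = cp s'.
Proof.
rewrite -(reach_state_law s' (leqnn l)) subnn /=.
rewrite (bigD1 sstar) //= /point_mass eqxx mul1r big1 ?addr0 // => s.
by move=> /negbTE ->; rewrite mul0r.
Qed.

(** One round of chasing and returning costs at most [l + D], and about [1 / pmin] rounds are
    expected. This bounds the expected time needed from [sstar]. *)
Definition attempt_cost := (l%:R + D) / pmin.
Let W := attempt_cost.

Lemma D_ge0 : 0 <= D. Proof. exact: le_trans (h_ge0 sstar) (h_le _). Qed.

Lemma attempt_cost_ge0 : 0 <= W.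
Proof. by rewrite divr_ge0 ?addr_ge0 ?ler0n ?D_ge0 ?ltW. Qed.

Lemma attempt_cost_ineq : l%:R + (1 - pmin) * (D + W) <= W.
Proof.
have WE : pmin * W = l%:R + D.
  by rewrite /W /attempt_cost mulrCA mulfV ?mulr1 // gt_eqF.
have := mulr_ge0 (ltW pmin_gt0) D_ge0; lra.
Qed.

(* Expected remaining time until the learner follows q t, as long as q t does
   not change; the configurations which never occur get a large value. *)
Definition potential (s : S) (m : mode S l) : R :=
  match m with
  | Follow => 0
  | Move => if s == sstar then 1 + D + W else h s + W
  | Catch s' k =>
    if (k < l)%N
    then (l - k)%:R + (1 - reach s' (l - k) s * success_prob s') * (D + W)
    else l%:R + 1 + D + W
  end.

Lemma potential_catch0_le s s' :
  potential s (Catch s' ord0) <= l%:R + D + W.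
Proof.
rewrite /= l_gt0 subn0 -addrA lerD2l mulrBl mul1r gerBl.
apply: mulr_ge0; last by rewrite addr_ge0 ?D_ge0 ?attempt_cost_ge0.
by apply: mulr_ge0; [exact: reach_ge0|exact: success_prob_ge0].
Qed.

(** Used when the leader changes: the discarded potential pays for the unit that [away] charges at
    that step. *)
Lemma potential_ge s m : (m != Follow)%:R <= potential s m.
Proof.
have D0 := D_ge0; have W0 := attempt_cost_ge0; have h0 := h_ge0 s.
case: m => [||s' k] //=.
  case: (eqVneq s sstar) => [_|/h_step h1]; first by rewrite -addrA lerDl addr_ge0.
  apply: ler_wpDr => //; apply: le_trans h1; rewrite lerDl.
  by apply: sumr_ge0 => u _; rewrite mulr_ge0 ?step_ge0.
case: ltnP => kl; last by rewrite -!addrA (addrCA _ 1) lerDl !addr_ge0.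
apply: ler_wpDr; last by rewrite ler1n subn_gt0.
apply: mulr_ge0; last exact: addr_ge0.
rewrite subr_ge0.
have : reach s' (l - k) s <= 1.
  elim: (l - k)%N s {h0} => [|j IH] s /=; first by rewrite /point_mass lern1 leq_b1.
  exact: step_avg_le.
move=> r1; apply: le_trans (success_prob_le1 s').
by rewrite ler_piMl // success_prob_ge0.
Qed.

Lemma chase_potential t s :
  \sum_(m : mode S l) chase M d1 sstar q t s m * potential s m <= h s + W.
Proof.
rewrite chase_sum; case: (eqVneq s sstar) => [->|/negbTE ss]; last first.
  by rewrite /= ss.
rewrite h_sstar add0r /= l_gt0 subn0; apply: le_trans attempt_cost_ineq.
(* Thanks to the Bernoulli draw every target succeeds with the same probability [pmin], so the
   random target averages out. *)
under eq_bigr => s' _.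
  rewrite reach_sstar (_ : cp s' * success_prob s' = pmin); last first.
    by rewrite /success_prob mulrCA mulfV ?mulr1 // gt_eqF // catch_prob_gt0.
over.
by rewrite -mulr_suml occupation_sum1 mul1r.
Qed.

Lemma chase_potential_le t s :
  \sum_(m : mode S l) chase M d1 sstar q t s m * potential s m <= D + W.
Proof. by apply: le_trans (chase_potential t s) _; rewrite lerD2r. Qed.

Lemma potential_step t s m : q t.+1 = q t ->
  \sum_u step M (act goto catch q t m) s u *
    \sum_m' upd t (next_mode m) u m' * potential u m'
  <= potential s m - (m != Follow)%:R.
Proof.
move=> qq.
have D0 := D_ge0; have W0 := attempt_cost_ge0.
rewrite /upd /update_mode qq eqxx /=; case: m => [||s' k] /=.
- rewrite subr0 big1 // => u _; rewrite point_mass_sum /=.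
  by rewrite mulr0.
- case: (eqVneq s sstar) => [->|ss].
    rewrite (_ : _ - _ = D + W); last by rewrite /=; lra.
    by apply: step_avg_le => u; exact: chase_potential_le.
  apply: (@le_trans _ _ (\sum_u step M goto s u * (h u + W))).
    by apply: ler_sum => u _; rewrite ler_wpM2l ?step_ge0 // chase_potential.
  under eq_bigr do rewrite mulrDr.
  rewrite big_split /= step_avg_cst.
  have := h_step ss; lra.
- case: (ltnP k l) => kl; last first.
    (* [inord] sends the out-of-range [l.+1] to [ord0]: this impossible configuration would restart
       the chase, which its potential [l + 1 + D + W] covers. *)
    rewrite (_ : inord k.+1 = ord0 :> 'I_l.+1); last first.
      by apply: val_inj => /=; rewrite /inord val_insubd ltnS ltnNge kl.
    rewrite /= l_gt0; under eq_bigr do rewrite point_mass_sum.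
    rewrite (_ : _ - _ = l%:R + D + W); last by rewrite /=; lra.
    by apply: step_avg_le => u; exact: potential_catch0_le.
  rewrite (_ : _ - _ = (l - k.+1)%:R +
      (1 - reach s' (l - k) s * success_prob s') * (D + W)); last first.
    by rewrite -(subnSK kl) -natr1 /=; lra.
  rewrite inordK ?ltnS //.
  (* [reach] is harmonic along the chase, so averaging over one step loses nothing. *)
  have avg : (l - k.+1)%:R + (1 - reach s' (l - k) s * success_prob s') * (D + W) =
     \sum_u step M (catch s' k) s u *
       ((l - k.+1)%:R + (1 - reach s' (l - k.+1) u * success_prob s') * (D + W)).
    under eq_bigr do rewrite mulrDr mulrBl mul1r mulrBr -!mulrA (mulrA (step _ _ _ _)).
    rewrite big_split sumrB /= !step_avg_cst -mulr_suml -(subnSK kl) /=.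
    by rewrite subnSK // subKn ?mulrBl ?mul1r -?mulrA // ltnW.
  rewrite avg; apply: ler_sum => u _; rewrite ler_wpM2l ?step_ge0 //.
  case: ltnP => kl1.
    by rewrite point_mass_sum /= inordK ?ltnS // kl1.
  have -> : (l - k.+1 = 0)%N by apply/eqP; rewrite subn_eq0.
  rewrite chase_end_sum add0r /= /point_mass mulr0 add0r.
  case: (eqVneq u s') => [->|us].
    by rewrite mul1r ler_wpM2l ?subr_ge0 ?success_prob_le1 // chase_potential_le.
  by rewrite mul0r subr0 mul1r chase_potential_le.
Qed.

Lemma potential_switch t s m : q t.+1 != q t ->
  \sum_u step M (act goto catch q t m) s u *
    \sum_m' upd t (next_mode m) u m' * potential u m' <= D + W.
Proof.
move=> qq; apply: step_avg_le => u.
by rewrite /upd /update_mode qq chase_potential_le.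
Qed.

Definition away t := \sum_c config t c * (c.2 != Follow)%:R.

(** The potential telescopes from 0, since the learner starts in [Follow]. A switch during an
    execution just resets it to at most [D + W], so aborted executions need no separate
    treatment. *)
Lemma away_sum T :
  \sum_(t < T) away t <= (D + W) * \sum_(t < T) (q t.+1 != q t)%:R.
Proof.
have DW0 : 0 <= D + W by rewrite addr_ge0 ?D_ge0 ?attempt_cost_ge0.
pose Phi t := \sum_c config t c * potential c.1 c.2.
have Phi0 : Phi 0%N = 0.
  rewrite /Phi big1 // => -[s m] _ /=; rewrite /point_mass.
  by case: eqP => [->|_]; rewrite ?mulr0 ?mul0r.
have PhiS t : Phi t.+1 <= Phi t - away t + (D + W) * (q t.+1 != q t)%:R.
  rewrite /Phi configS_sum /away -sumrB.
  case: (eqVneq (q t.+1) (q t)) => qq.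
    rewrite mulr0 addr0; apply: ler_sum => c _; rewrite -mulrBr.
    by rewrite ler_wpM2l ?config_ge0 // potential_step.
  rewrite mulr1 -[X in _ + X]mul1r -[X in _ + X * _](config_sum1 t).
  rewrite mulr_suml -big_split /=; apply: ler_sum => c _.
  rewrite -mulrBr -mulrDr ler_wpM2l ?config_ge0 //.
  apply: le_trans (potential_switch _ _ qq) _; rewrite lerDr subr_ge0.
  exact: potential_ge.
have Phi_away t : \sum_(i < t) away i + Phi t <=
    (D + W) * \sum_(i < t) (q i.+1 != q i)%:R.
  elim: t => [|t IH]; first by rewrite !big_ord0 Phi0 mulr0 addr0.
  by rewrite !big_ord_recr /= mulrDr; have := PhiS t; lra.
apply: le_trans (Phi_away T); rewrite lerDl.
apply: sumr_ge0 => c _; rewrite mulr_ge0 ?config_ge0 //.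
by apply: le_trans (potential_ge _ _); exact: ler0n.
Qed.

Variables (T : nat) (ell : nat -> S -> A -> R).
Hypothesis ell01 : forall t s b, (t < T)%N -> 0 <= ell t s b <= 1.

Lemma hat_loss_ge0 t pi : (t < T)%N -> 0 <= hat_loss M d1 ell t pi.
Proof.
move=> tT; apply: sumr_ge0 => s _; rewrite mulr_ge0 ?occupation_ge0 //.
apply: sumr_ge0 => b _; rewrite mulr_ge0 ?fd_ge0 //.
by have /andP[] := ell01 s b tT.
Qed.

Lemma act_loss_le1 t (mu : policy R S A) s : (t < T)%N ->
  \sum_b mu s b * ell t s b <= 1.
Proof.
move=> tT; rewrite -(fd_sum1 (mu s)); apply: ler_sum => b _.
by rewrite ler_piMr ?fd_ge0 //; have /andP[] := ell01 s b tT.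
Qed.

Lemma hat_loss_le1 t pi : (t < T)%N -> hat_loss M d1 ell t pi <= 1.
Proof.
move=> tT; rewrite -(occupation_sum1 pi t); apply: ler_sum => s _.
by rewrite ler_piMr ?occupation_ge0 // act_loss_le1.
Qed.

(** In mode [Follow] the loss is [F * hat_loss], with [F <= 1] because [F] is the probability of
    that mode; nonnegative losses allow [F] to be dropped. Every other mode is charged 1 through
    [away]. *)
Lemma learner_loss_le :
  learner_loss M d1 T ell sstar goto l catch q <=
  \sum_(t < T) hat_loss M d1 ell t (q t) +
  (D + W) * \sum_(t < T) (q t.+1 != q t)%:R.
Proof.
apply: le_trans (lerD (lexx _) (away_sum T)).
rewrite -big_split /=; apply: ler_sum => -[t tT] _ /=.
have [F FE] := config_follow t.
pose g (c : S * mode S l) := \sum_b act goto catch q t c.2 c.1 b * ell t c.1 b.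
have gE : \sum_c config t c * g c <=
    \sum_s config t (s, Follow) * g (s, Follow) + away t.
  have -> : \sum_s config t (s, Follow) * g (s, Follow) =
      \sum_c config t c * ((c.2 == Follow)%:R * g c).
    rewrite sum_pair /=.
    apply: eq_bigr => s _; rewrite (bigD1 Follow) //= mul1r big1 ?addr0 //.
    by move=> m /negbTE ->; rewrite mul0r mulr0.
  rewrite -big_split /=; apply: ler_sum => c _; rewrite -mulrDr.
  rewrite ler_wpM2l ?config_ge0 //; case: eqP => _; first by rewrite mul1r addr0.
  by rewrite mul0r add0r act_loss_le1.
apply: le_trans gE _; rewrite lerD2r.
have F1 : F <= 1.
  rewrite -(config_sum1 t) sum_pair /=.
  rewrite -[F]mulr1 -(occupation_sum1 (q t) t) mulr_sumr; apply: ler_sum => s _.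
  rewrite -FE (bigD1 Follow) //= lerDl.
  by apply: sumr_ge0 => m _; exact: config_ge0.
rewrite -[leRHS]mul1r; apply: le_trans (ler_wpM2r (hat_loss_ge0 _ tT) F1).
rewrite /hat_loss mulr_sumr le_eqVlt; apply/orP; left; apply/eqP.
by apply: eq_bigr => s _; rewrite FE /g /= -mulrA.
Qed.

Lemma learner_loss_ge0 : 0 <= learner_loss M d1 T ell sstar goto l catch q.
Proof.
apply: sumr_ge0 => -[t tT] _; apply: sumr_ge0 => c _ /=.
rewrite mulr_ge0 ?config_ge0 //; apply: sumr_ge0 => b _.
by rewrite mulr_ge0 ?fd_ge0 //; have /andP[] := ell01 c.1 b tT.
Qed.

End Process.

(** * Hitting times *)

Section HittingTimes.
Variables (R : realType) (S A : finType) (M : mdp R S A).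
Implicit Types (mu : policy R S A).

Lemma path_prob_ge0 mu s x : 0 <= path_prob M mu s x.
Proof. by elim: x s => //= u x IH s; rewrite mulr_ge0 ?step_ge0. Qed.

Lemma hit_prob_ge0 mu s s' k : 0 <= hit_prob M mu s s' k.
Proof. by apply: sumr_ge0 => x _; exact: path_prob_ge0. Qed.

Lemma hit_probS mu s s' k : hit_prob M mu s s' k.+1 =
  (s != s')%:R * \sum_u step M mu s u * hit_prob M mu u s' k.
Proof.
rewrite /hit_prob (reindex (fun p : S * k.-tuple S => [tuple of p.1 :: p.2])) /=; last first.
  exists (fun x : k.+1.-tuple S => (thead x, [tuple of behead x])).
    by case=> u x _ /=; congr pair; apply: val_inj.
  by move=> x _ /=; rewrite [RHS]tuple_eta.
case: (eqVneq s s') => [_|ss] /=; first by rewrite mul0r big_pred0.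
rewrite mul1r; under [RHS]eq_bigr do rewrite mulr_sumr.
rewrite pair_big_dep /=; apply: eq_bigl => -[u x] /=.
by rewrite eqSS.
Qed.

Lemma hit_prob0 mu s s' : hit_prob M mu s s' 0 = (s == s')%:R.
Proof.
rewrite /hit_prob (eq_bigl (fun x : 0.-tuple S => (s == s') && (x == [tuple]))).
  case: eqP => _; last by rewrite big_pred0.
  by rewrite big_pred1_eq.
by move=> x; rewrite (tuple0 x) /= eqxx andbT; case: (s == s').
Qed.

Lemma hit_prob_sum_le1 mu s s' n : \sum_(k < n) hit_prob M mu s s' k <= 1.
Proof.
elim: n s => [|n IH] s; first by rewrite big_ord0.
rewrite big_ord_recl hit_prob0; under eq_bigr do rewrite /= hit_probS.
rewrite -mulr_sumr exchange_big /=.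
under eq_bigr do rewrite -mulr_sumr.
case: eqP => _; rewrite ?mul0r ?addr0 // add0r mul1r.
exact: step_avg_le.
Qed.

Local Open Scope ereal_scope.

Definition hit_total mu s s' := \sum_(0 <= k <oo) (hit_prob M mu s s' k)%:E.
Definition hit_mean mu s s' := \sum_(0 <= k <oo) (k%:R * hit_prob M mu s s' k)%:E.

Let hE0 mu s s' k : 0 <= (hit_prob M mu s s' k)%:E.
Proof. by rewrite lee_fin hit_prob_ge0. Qed.

Let khE0 mu s s' k : 0 <= (k%:R * hit_prob M mu s s' k)%:E.
Proof. by rewrite lee_fin mulr_ge0 ?hit_prob_ge0. Qed.

Lemma hit_total_le1 mu s s' : hit_total mu s s' <= 1.
Proof.
apply: lime_le; first exact: is_cvg_nneseries.
by near=> n; rewrite big_mkord sumEFin lee_fin hit_prob_sum_le1.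
Unshelve. all: by end_near. Qed.

Lemma hit_mean_ge0 mu s s' : 0 <= hit_mean mu s s'.
Proof. exact: nneseries_ge0. Qed.

(** A positive chance of never reaching [s'] would make the correction term infinite. *)
Lemma expected_hit_fin mu s s' : expected_hit M mu s s' < +oo ->
  hit_total mu s s' = 1 /\ expected_hit M mu s s' = hit_mean mu s s'.
Proof.
rewrite /expected_hit -/(hit_total _ _ _) -/(hit_mean _ _ _) => fin.
suff t1 : hit_total mu s s' = 1.
  by split=> //; rewrite t1 subee // mule0 adde0.
apply/eqP; rewrite eq_le hit_total_le1 /= leNgt; apply/negP => lt1.
move: fin; rewrite gt0_mulye ?sube_gt0 //.
by rewrite addey ?ltxx // gt_eqF // (lt_le_trans _ (hit_mean_ge0 _ _ _)) ?ltNy0.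
Qed.

(** First-step analysis. Splitting the factor [k.+1] into [k] and 1 yields [hit_total], which
    becomes the usual 1 once [s'] is known to be reached almost surely. *)
Lemma hit_mean_step mu s s' : s != s' ->
  \sum_u (step M mu s u)%:E * (hit_mean mu u s' + hit_total mu u s')
  = hit_mean mu s s'.
Proof.
move=> ss.
rewrite [RHS]/hit_mean nneseries_recl // mul0r add0e.
rewrite -[RHS](@nneseries_addn _ _ 1) //.
under [RHS]eq_eseriesr => k _.
  rewrite addn1 hit_probS ss mul1r mulr_sumr -sumEFin.
  under eq_bigr => u _ do rewrite mulrCA -natr1 mulrDl mul1r EFinM EFinD.
over.
rewrite nneseries_sum; last first.
  move=> u k _; rewrite mule_ge0 ?lee_fin ?step_ge0 //.
  by rewrite addr_ge0 ?mulr_ge0 ?hit_prob_ge0.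
apply: eq_bigr => u _; rewrite nneseriesZl; last first.
  by move=> k _; rewrite lee_fin addr_ge0 ?mulr_ge0 ?hit_prob_ge0.
by rewrite nneseriesD.
Qed.

Lemma hit_mean_self mu s : hit_mean mu s s = 0.
Proof.
rewrite /hit_mean eseries0 // => -[|k] _ _; first by rewrite mul0r.
by rewrite hit_probS eqxx mul0r mulr0.
Qed.

Lemma hit_total_le_mean mu s s' : s != s' -> hit_total mu s s' <= hit_mean mu s s'.
Proof.
move=> ss; apply: lee_nneseries => // -[_|k _]; rewrite lee_fin.
  by rewrite hit_prob0 (negbTE ss) mulr0.
by rewrite ler_peMl ?hit_prob_ge0 // ler1n.
Qed.

Lemma best_hit_ge1 s s' : s != s' -> 1 <= best_hit M s s'.
Proof.
move=> ss; apply: le_ereal_inf_tmp => _ [mu _ <-].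
case: (ltP (expected_hit M mu s s') +oo) => [|/(le_trans _)]; last by apply; rewrite leey.
by move=> /expected_hit_fin [t1 ->]; rewrite -t1 hit_total_le_mean.
Qed.

Lemma best_hit_le_diameter s s' : s != s' -> best_hit M s s' <= diameter M.
Proof. by move=> ss; rewrite /diameter (bigD1 (s, s')) //= le_max lexx. Qed.

Hypotheses (S_gt1 : (1 < #|S|)%N) (comM : communicating M).

Lemma diameterE : diameter M = (diam M)%:E.
Proof.
rewrite fineK // ge0_fin_numE //.
have /card_gt1P [s [s' [_ _ ss]]] := S_gt1.
apply: le_trans (best_hit_le_diameter ss).
by apply: le_trans (best_hit_ge1 ss).
Qed.

Lemma diam_ge1 : (1 <= diam M)%R.
Proof.
have /card_gt1P [s [s' [_ _ ss]]] := S_gt1.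
rewrite -lee_fin -diameterE; apply: le_trans (best_hit_le_diameter ss).
exact: best_hit_ge1.
Qed.

(** [h] is the mean hitting time of [sstar] under [goto]. It is at most the diameter, hence finite,
    so [sstar] is reached almost surely and [hit_mean_step] applies with [hit_total] equal to 1. *)
Lemma best_policy_time (goto : policy R S A) (sstar : S) :
  best_policy_to M sstar goto ->
  exists h : S -> R, [/\ forall s, (0 <= h s <= diam M)%R, h sstar = 0%R &
    forall s, s != sstar -> (1 + \sum_u step M goto s u * h u <= h s)%R].
Proof.
move=> best.
have mean_le s : hit_mean goto s sstar <= (diam M)%:E.
  have [->|ss] := eqVneq s sstar.
    by rewrite hit_mean_self lee_fin (le_trans _ diam_ge1).
  have le_D : expected_hit M goto s sstar <= (diam M)%:E.
    by rewrite best -diameterE best_hit_le_diameter.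
  by have [_ <-] := expected_hit_fin (le_lt_trans le_D (ltry _)).
have total1 s : hit_total goto s sstar = 1.
  have [->|ss] := eqVneq s sstar.
    apply/eqP; rewrite eq_le hit_total_le1 /hit_total nneseries_recl //.
    by rewrite hit_prob0 eqxx leeDl // nneseries_ge0.
  apply: (expected_hit_fin _).1; rewrite best.
  by apply: le_lt_trans (best_hit_le_diameter ss) _; rewrite diameterE ltry.
have meanE s : hit_mean goto s sstar = (fine (hit_mean goto s sstar))%:E.
  rewrite fineK // ge0_fin_numE ?hit_mean_ge0 //.
  exact: le_lt_trans (mean_le s) (ltry _).
exists (fun s => fine (hit_mean goto s sstar)); split=> [s||s ss].
- by rewrite -!lee_fin -meanE hit_mean_ge0 mean_le.
- by rewrite hit_mean_self.
rewrite -lee_fin -meanE -(hit_mean_step goto ss) -[X in (X + _)%R](step_sum1 M goto s).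
rewrite -big_split /= -sumEFin; apply: lee_sum => u _.
by rewrite total1 [in leRHS]meanE -EFinD -EFinM lee_fin mulrDr mulr1 addrC.
Qed.

End HittingTimes.

(** * Existence of catching policies *)

Section Catching.
Variables (R : realType) (S A : finType) (M : mdp R S A).
Implicit Types (nu : nspolicy R S A).

Lemma state_law_cat (d : S -> R) nu i j :
  state_law M d nu (i + j) = state_law M (state_law M d nu i) (fun m => nu (i + m)%N) j.
Proof.
elim: j => [|j IH]; first by rewrite addn0.
by rewrite addnS /= IH.
Qed.

(** A first visit at time [k] is in particular a visit at time [k]. The induction needs an arbitrary
    initial weight [d]. *)
Lemma hit_prob_le_state_law (mu : policy R S A) (d : S -> R) s' k :
  (forall s, 0 <= d s) ->
  \sum_s d s * hit_prob M mu s s' k <= state_law M d (fun=> mu) k s'.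
Proof.
elim: k d => [|k IH] d d0.
  rewrite /= (bigD1 s') //= hit_prob0 eqxx mulr1 big1 ?addr0 // => s /negbTE ss.
  by rewrite hit_prob0 ss mulr0.
rewrite -add1n state_law_cat /=; apply: le_trans (IH _ _); last first.
  by move=> s; apply: sumr_ge0 => u _; rewrite mulr_ge0 ?step_ge0.
under [leRHS]eq_bigr do rewrite mulr_suml.
rewrite exchange_big /=; apply: ler_sum => s _.
under [leRHS]eq_bigr do rewrite -mulrA.
rewrite -mulr_sumr ler_wpM2l // hit_probS ler_piMl ?lern1 ?leq_b1 //.
by apply: sumr_ge0 => u _; rewrite mulr_ge0 ?step_ge0 ?hit_prob_ge0.
Qed.

Variables (sstar : S) (a : A).
Hypothesis loop : M sstar a sstar = 1.

Lemma step_loop u :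
  step M (of_det R [ffun=> a]) sstar u = point_mass R sstar u.
Proof.
have -> : step M (of_det R [ffun=> a]) sstar u = M sstar a u.
  rewrite /step (bigD1 a) //= ffunE /point_mass eqxx mul1r big1 ?addr0 // => b.
  by move=> /negbTE ->; rewrite mul0r.
rewrite /point_mass; case: eqVneq => [->|us]; first by rewrite loop.
apply/eqP; rewrite eq_le fd_ge0 andbT -(lerD2l (M sstar a sstar)) addr0 [leRHS]loop.
rewrite -(fd_sum1 (M sstar a)) (bigD1 sstar) //= (bigD1 u) //= addrA lerDl.
by apply: sumr_ge0 => v _; exact: fd_ge0.
Qed.

Lemma state_law_loop t :
  state_law M (point_mass R sstar) (fun=> of_det R [ffun=> a]) t
  = point_mass R sstar.
Proof.
elim: t => [|t IH] //=; apply/funext => u; rewrite IH.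
rewrite (bigD1 sstar) //= {1}/point_mass eqxx mul1r step_loop big1 ?addr0 //.
by move=> s /negbTE ss; rewrite /point_mass ss mul0r.
Qed.

Lemma state_law_eq (d : S -> R) nu nu' t :
  (forall i, (i < t)%N -> nu i = nu' i) -> state_law M d nu t = state_law M d nu' t.
Proof.
elim: t => [|t IH] nn //=; rewrite IH ?nn // => i it.
by rewrite nn // ltnW.
Qed.

(* Waiting in sstar makes all the chases last the same number of steps. *)
Lemma wait_then_walk (mu : policy R S A) s' l k : (k <= l)%N ->
  exists nu, hit_prob M mu sstar s' k <= state_law M (point_mass R sstar) nu l s'.
Proof.
move=> kl.
exists (fun i => if (i < l - k)%N then of_det R [ffun=> a] else mu).
rewrite -[X in state_law _ _ _ X](subnK kl) state_law_cat.
rewrite (@state_law_eq _ _ (fun=> of_det R [ffun=> a]) (l - k)); last by move=> i ->.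
rewrite state_law_loop.
rewrite (@state_law_eq _ _ (fun=> mu)); last by move=> i _; rewrite ltnNge leq_addr.
apply: le_trans (hit_prob_le_state_law _ _ _ _); last by move=> s; exact: point_ge0.
rewrite (bigD1 sstar) //= /point_mass eqxx mul1r lerDl.
by apply: sumr_ge0 => s _; rewrite mulr_ge0 ?hit_prob_ge0 ?ler0n.
Qed.

Hypotheses (S_gt1 : (1 < #|S|)%N) (comM : communicating M).
Let D := diam M.

(* By Markov's inequality s' is hit within l steps with probability at least
   1 / 2, hence at one of these l <= 2 D times with probability 1 / (4 D). *)
Lemma exists_likely_hit s' : s' != sstar ->
  exists mu k, (k <= Num.truncn (2 * D))%N /\ 1 / (4 * D) <= hit_prob M mu sstar s' k.
Proof.
move=> ss; have D1 : 1 <= D := diam_ge1 S_gt1 comM.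
set l := Num.truncn _.
have lD : l%:R <= 2 * D by rewrite truncn_le //; lra.
have Dl : 2 * D < l.+1%:R by rewrite truncnS_gt.
(* The infimum need not be attained; the strict inequality [2 * D < l.+1] leaves room for choosing
   [mu]. *)
have : (best_hit M sstar s' < (l.+1%:R / 2)%:E)%E.
  apply: (@le_lt_trans _ _ (D%:E)); last by rewrite lte_fin; lra.
  by rewrite -diameterE // best_hit_le_diameter // eq_sym.
move=> /ereal_inf_lt[_ [mu _ <-] muE].
have [t1 eE] := expected_hit_fin (lt_trans muE (ltry _)).
rewrite eE in muE.
suff [k kl kE] : exists2 k : 'I_l.+1, true & 1 / (4 * D) <= hit_prob M mu sstar s' k.
  by exists mu, k; rewrite -ltnS ltn_ord.
apply: contrapT => nex.
have small k : (k < l.+1)%N -> hit_prob M mu sstar s' k <= 1 / (4 * D).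
  move=> kl; rewrite leNgt; apply/negP => kk; apply: nex.
  by exists (Ordinal kl) => //; exact: ltW.
pose f k := (hit_prob M mu sstar s' k)%:E.
have f0 k : (0 <= f k)%E by rewrite lee_fin hit_prob_ge0.
have g0 k : (0 <= (k%:R * hit_prob M mu sstar s' k)%:E)%E.
  by rewrite lee_fin mulr_ge0 ?hit_prob_ge0.
(* The term at 0 vanishes as [s' != sstar], which leaves [l <= 2 * D] terms of at most
   [1 / (4 * D)]. *)
have half : (\sum_(0 <= k < l.+1) f k <= (1/2)%:E)%E.
  rewrite sumEFin lee_fin big_nat_recl // hit_prob0 eq_sym (negbTE ss) add0r.
  apply: (@le_trans _ _ (\sum_(0 <= i < l) (1 / (4 * D)))).
    by rewrite !big_mkord; apply: ler_sum => -[i il] _; exact: small.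
  rewrite sumr_const_nat subn0 -[leLHS]mulr_natl mulrA mulr1.
  by rewrite ler_pdivrMr ?mulr_gt0 //; lra.
have tot := nneseries_split 0 l.+1 (fun k _ => f0 k).
have mean := nneseries_split 0 l.+1 (fun k _ => g0 k).
rewrite !add0n in tot mean.
have tailge : ((l.+1%:R)%:E * \sum_(l.+1 <= k <oo) f k <=
    \sum_(l.+1 <= k <oo) (k%:R * hit_prob M mu sstar s' k)%:E)%E.
  rewrite -nneseriesZl // -nneseries_addn; last by move=> k; rewrite mule_ge0.
  rewrite -[leRHS]nneseries_addn //; apply: lee_nneseries => [k _ _|k _].
    by rewrite mule_ge0.
  by rewrite -EFinM lee_fin ler_wpM2r ?hit_prob_ge0 // ler_nat leq_addl.
have tail_half : ((1 / 2)%:E <= \sum_(l.+1 <= k <oo) f k)%E.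
  rewrite leNgt; apply/negP => tl.
  have : (\sum_(0 <= k < l.+1) f k + \sum_(l.+1 <= k <oo) f k < (1/2)%:E + (1/2)%:E)%E.
    by apply: lee_ltD => //; rewrite sumEFin.
  rewrite -tot [(\sum_(_ <= _ <oo) _)%E]t1 -EFinD lte_fin; lra.
move: muE; apply/negP; rewrite -leNgt.
rewrite /hit_mean mean -[leLHS]add0e; apply: leeD; first exact: sume_ge0.
apply: le_trans tailge; rewrite (_ : l.+1%:R / 2 = l.+1%:R * (1 / 2));
  last by rewrite mul1r.
by rewrite EFinM lee_wpmul2l // lee_fin.
Qed.

Lemma exists_catching :
  exists (l : nat) (catch : S -> nspolicy R S A), catching M sstar l catch.
Proof.
have D1 : 1 <= D := diam_ge1 S_gt1 comM.
exists (Num.truncn (2 * D)).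
have [s'|catch cP] := @choice _ _ (fun s' nu => 1 / (4 * D) <=
    state_law M (point_mass R sstar) nu (Num.truncn (2 * D)) s').
  have [->|ss] := eqVneq s' sstar.
    exists (fun=> of_det R [ffun=> a]); rewrite state_law_loop /point_mass eqxx.
    by rewrite ler_pdivrMr /= ?mulr1n; lra.
  have [mu [k [kl kE]]] := exists_likely_hit ss.
  by have [nu nuE] := wait_then_walk mu s' kl; exists nu; apply: le_trans nuE.
exists catch; split; last exact: cP.
by rewrite truncn_le //; rewrite -/D; lra.
Qed.

End Catching.

(** * The learner's loss in terms of the diameter and the switches *)

Section LearnerLoss.
Variables (R : realType) (S A : finType) (M : mdp R S A) (sstar : S).
Hypotheses (S_gt1 : (1 < #|S|)%N) (comM : communicating M).
Variables (l : nat) (catch : S -> nspolicy R S A) (goto : policy R S A).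
Hypotheses (catchingM : catching M sstar l catch)
  (bestM : best_policy_to M sstar goto).
Variables (d1 : fdist R S) (T : nat) (ell : nat -> S -> A -> R).
Hypothesis ell01 :
  forall (t : nat) (s : S) (b : A), (t < T)%N -> 0 <= ell t s b <= 1.
Variable q : nat -> detpolicy S A.
Let D := diam M.

Lemma min_catch_prob_ge : 1 / (4 * D) <= min_catch_prob M sstar l catch.
Proof.
have D1 : 1 <= D := diam_ge1 S_gt1 comM.
rewrite /min_catch_prob; elim/big_rec: _ => [|s x _ xD].
  by rewrite ler_pdivrMr; lra.
by rewrite le_min xD andbT; exact: catchingM.2.
Qed.

Lemma min_catch_prob_gt0 : 0 < min_catch_prob M sstar l catch.
Proof.
have D1 : 1 <= D := diam_ge1 S_gt1 comM.
by apply: lt_le_trans min_catch_prob_ge; rewrite divr_gt0 //; lra.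
Qed.

(** A chase of length 0 stays in [sstar] and cannot catch a second state. *)
Lemma catching_time_gt0 : (0 < l)%N.
Proof.
rewrite lt0n; apply/negP => /eqP l0.
have [s ss] : exists s, s != sstar.
  have /card_gt1P [s [s' [_ _ ss]]] := S_gt1.
  have [se|sn] := eqVneq s sstar; last by exists s.
  by exists s'; rewrite -se eq_sym.
have := lt_le_trans min_catch_prob_gt0 (min_catch_prob_le M sstar l catch s).
by rewrite /catch_prob l0 /= /point_mass (negbTE ss) ltxx.
Qed.

Lemma learner_loss_switches :
  learner_loss M d1 T ell sstar goto l catch q <=
  \sum_(t < T) hat_loss M d1 ell t (q t) +
  13 * D ^+ 2 * \sum_(t < T) (q t.+1 != q t)%:R.
Proof.
have D1 : 1 <= D := diam_ge1 S_gt1 comM.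
have [h [hD h0 hstep]] := best_policy_time S_gt1 comM bestM.
have h_ge0 s : 0 <= h s by have /andP[] := hD s.
have h_le s : h s <= D by have /andP[] := hD s.
apply: le_trans (learner_loss_le d1 q min_catch_prob_gt0 catching_time_gt0
  h_ge0 h_le h0 hstep ell01) _.
rewrite lerD2l; apply: ler_wpM2r; first by apply: sumr_ge0 => t _; exact: ler0n.
(* [l + D <= 3 * D], and dividing by [pmin >= 1 / (4 * D)] gives the factor 12. *)
have W_le : attempt_cost M sstar l catch D <= 12 * D ^+ 2.
  rewrite /attempt_cost ler_pdivrMr ?min_catch_prob_gt0 //.
  apply: (@le_trans _ _ (12 * D ^+ 2 * (1 / (4 * D)))); last first.
    by rewrite ler_wpM2l ?min_catch_prob_ge // mulr_ge0 // sqr_ge0.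
  have -> : 12 * D ^+ 2 * (1 / (4 * D)) = 3 * D by field; lra.
  by have := catchingM.1; rewrite -/D; lra.
have : D <= D ^+ 2 by rewrite expr2 ler_peMl //; lra.
lra.
Qed.

End LearnerLoss.

Local Open Scope classical_set_scope.

(** * Exponential noise *)

Section ExponentialTail.
Variables (R : realType) (m : probability R R).
Hypothesis m_exp : forall B : set R, measurable B -> m B = exponential_prob 1 B.
Local Open Scope ereal_scope.

Lemma exponential_itv0c (x : R) : (0 < x)%R -> m `[0%R, x] = (1 - expR (- x))%:E.
Proof. by move=> x0; rewrite m_exp // exponential_prob_itv0c // mulN1r EFinB. Qed.

Lemma expRN_le_inv (x : R) : (0 < x)%R -> (expR (- x) <= x^-1)%R.
Proof.
move=> x0; rewrite expRN lef_pV2 ?posrE ?expR_gt0 //.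
by apply: le_trans (expR_ge1Dx x); rewrite lerDr.
Qed.

(** The intervals [[0, x]] carry mass [1 - expR (- x)], hence all of it in the limit; [x = 1 / e]
    makes the missing mass at most [e]. *)
Lemma exponential_negative : m `]-oo, 0%R[ = 0.
Proof.
apply/eqP; rewrite eq_le measure_ge0 andbT; apply/lee_addgt0Pr => e e0.
rewrite add0e -setCitvr probability_setC //.
pose x : R := (e^-1)%R; have x0 : (0 < x)%R by rewrite invr_gt0.
apply: (@le_trans _ _ (1 - m `[0%R, x])%E).
  rewrite leeB //; apply: le_measure; rewrite ?inE //.
  by apply: subset_itvl; rewrite bnd_simp.
rewrite exponential_itv0c // -EFinB lee_fin subKr.
by apply: le_trans (expRN_le_inv x0) _; rewrite invrK.
Qed.

Lemma exponential_tail_gt0 (b : R) : (0 < b)%R -> m `]b, +oo[ = (expR (- b))%:E.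
Proof.
move=> b0; rewrite -setCitvl probability_setC //.
have -> : `]-oo, b] = `]-oo, 0%R[ `|` `[0%R, b].
  by rewrite -itv_bndbnd_setU // bnd_simp ltW.
rewrite measureU //; last first.
  by apply/seteqP; split=> x //= []; rewrite !in_itv /= => /lt_geF ->.
rewrite [X in 1 - (X + _)](_ : _ = 0); last exact: exponential_negative.
rewrite add0e [X in 1 - X]exponential_itv0c // -EFinB subKr //.
Qed.

Lemma exponential_tail (b : R) : m `]b, +oo[ = (expR (- Num.max b 0))%:E.
Proof.
have [b0|b0] := ltP 0%R b; first exact: exponential_tail_gt0.
rewrite oppr0 expR0; apply/eqP; rewrite eq_le probability_le1 //=.
apply/lee_addgt0Pr => e e0; rewrite -leeBlDr //.
apply: (@le_trans _ _ (m `]e, +oo[)).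
  rewrite exponential_tail_gt0 // -EFinB lee_fin.
  by apply: le_trans (expR_ge1Dx _); lra.
apply: le_measure; rewrite ?inE //.
by apply: subset_itvr; rewrite bnd_simp; lra.
Qed.

End ExponentialTail.

(** * Measurability of maps into finite types *)

Section FiniteValued.
Context d (T : measurableType d) (R : realType).

Lemma measure_fiber_sum (mu : {measure set T -> \bar R}) (I : finType) (f : T -> I)
    (A : set T) :
  measurable A -> (forall i, measurable (f @^-1` [set i])) ->
  mu A = (\sum_i mu (A `&` f @^-1` [set i]))%E.
Proof.
move=> mA mf.
have fI : finite_set [set: I] := finite_finset.
have -> : (\sum_i mu (A `&` f @^-1` [set i]) =
    \sum_(i <- fset_set [set: I]) mu (A `&` f @^-1` [set i]))%E.
  apply: perm_big; apply: uniq_perm; rewrite ?index_enum_uniq ?fset_uniq //.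
  by move=> i; rewrite mem_index_enum in_fset_set // mem_set.
rewrite -fsbig_finite // -measure_fin_bigcup //; first last.
- by move=> i _; exact: measurableI.
- by move=> i j _ _ [t [[_ /= <-] [_ /= ->]]].
congr (mu _); apply/seteqP; split=> [t At|t [i _ []//]].
by exists (f t).
Qed.

Lemma measurable_table (J : finType) (Z : Type) (phi : {ffun J -> bool} -> Z)
    (b : J -> T -> bool) (z : Z) :
  (forall j, measurable_fun setT (b j)) ->
  measurable [set t | phi [ffun j => b j t] = z].
Proof.
move=> mb.
have -> : [set t | phi [ffun j => b j t] = z] =
    \bigcup_(g in [set g | phi g = z]) \bigcap_(j in setT) (b j @^-1` [set g j]).
  apply/seteqP; split=> [t /= tz|t [g /= gz gt]].
    by exists [ffun j => b j t] => // j _ /=; rewrite ffunE.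
  by rewrite -gz; congr phi; apply/ffunP => j; rewrite ffunE; exact: gt.
apply: fin_bigcup_measurable => [|g _]; first exact: finite_finset.
apply: fin_bigcap_measurable => [|j _]; first exact: finite_finset.
by rewrite -[X in measurable X]setTI; exact: mb.
Qed.

(** The minimizer depends on the values only through the finite table of their comparisons. *)
Lemma measurable_arg_min (I : finType) (i0 i : I) (F : I -> T -> R) :
  (forall j, measurable_fun setT (F j)) ->
  measurable [set t | [arg min_(j < i0) F j t]%O = i].
Proof.
move=> mF.
pose phi (g : {ffun I * I -> bool}) : I :=
  odflt i0 [pick k | [forall j, g (k, j)]].
rewrite [X in measurable X](_ : _ =
    [set t | phi [ffun p => F p.1 t <= F p.2 t] = i]); last first.
  apply/seteqP; split=> t /= <-; rewrite /phi /Order.arg_min /extremum; congr (odflt _ _).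
    by apply: eq_pick => k /=; apply: eq_forallb => j; rewrite ffunE.
  by apply: eq_pick => k /=; apply: eq_forallb => j; rewrite ffunE.
by apply: (@measurable_table _ _ phi) => -[k j] /=; exact: measurable_fun_ler.
Qed.

End FiniteValued.

(** * The sigma-algebra of noise vectors and the memoryless property *)

Definition noise (R : realType) (I : finType) := I -> R.

HB.instance Definition _ (R : realType) (I : finType) := gen_eqMixin (noise R I).
HB.instance Definition _ (R : realType) (I : finType) :=
  gen_choiceMixin (noise R I).
HB.instance Definition _ (R : realType) (I : finType) :=
  isPointed.Build (noise R I) (fun=> 0).

Section Memoryless.
Context (R : realType) (I : finType) d (Omega : measurableType d)
  (P : probability Omega R) (X : I -> {RV P >-> R}).

Definition half_line (b : option R) : set R :=
  if b is Some c then `]c, +oo[ else setT.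

(** Upper half-lines are closed under intersection, generate the Borel sets and have an explicit
    exponential probability. [None] stands for no constraint on that coordinate. *)
Definition cylinder (b : I -> option R) : set (noise R I) :=
  [set x | forall i, half_line (b i) (x i)].

Definition cylinders : set (set (noise R I)) := range cylinder.

Definition noise_space := g_sigma_algebraType cylinders.

HB.instance Definition _ := Measurable.on noise_space.

Lemma measurable_half_line b : measurable (half_line b).
Proof. by case: b => //= c; exact: measurable_itv. Qed.

Lemma cylinders_setI : setI_closed cylinders.
Proof.
move=> _ _ [b _ <-] [c _ <-].
pose m i := if b i is Some u then if c i is Some v then Some (Num.max u v) else Some u
            else c i.
exists m => //; apply/seteqP; split=> [x mx|x [bx cx] i].
  split=> i; move: (mx i); rewrite /m; case: (b i) => [u|]; case: (c i) => [v|] //=;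
    by rewrite !in_itv /= !andbT gt_max => /andP[].
move: (bx i) (cx i); rewrite /m; case: (b i) => [u|]; case: (c i) => [v|] //=.
by rewrite !in_itv /= !andbT gt_max => -> ->.
Qed.

Lemma measurable_coord i : measurable_fun setT (fun x : noise_space => x i).
Proof.
move=> mT; apply: (measurability _ (RGenOInfty.measurableE R)) => // _ [_ [c ->] <-].
rewrite setTI; apply: sub_sigma_algebra.
exists (fun j => if j == i then Some c else None) => //.
apply/seteqP; split=> x /=; first by move=> /(_ i); rewrite eqxx.
by move=> xi j; case: eqP => [->|].
Qed.

Lemma measurable_noise d' (T : measurableType d') (f : T -> noise_space) :
  (forall i, measurable_fun setT (fun t => f t i)) -> measurable_fun setT f.
Proof.
move=> mf; apply: (@measurability _ _ _ _ setT f cylinders) => // _ [_ [b _ <-] <-].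
rewrite setTI (_ : _ @^-1` _ =
  \bigcap_(i in setT) ((fun t => f t i) @^-1` half_line (b i))); last first.
  by apply/seteqP; split=> t /= h i; [move=> _|]; apply: h.
apply: fin_bigcap_measurable => [|i _]; first exact: finite_finset.
by rewrite -[X in measurable X]setTI; apply: mf => //; exact: measurable_half_line.
Qed.

Definition sample w : noise_space := fun i => X i w.

Lemma measurable_sample : measurable_fun setT sample.
Proof. by apply: measurable_noise => i; exact: measurable_funPT. Qed.

Definition shift (i : I) (c : R) (x : noise_space) : noise_space :=
  fun j => x j - (j == i)%:R * c.

Lemma measurable_shift i c : measurable_fun setT (shift i c).
Proof.
apply: measurable_noise => j.
by apply: measurable_funB; [exact: measurable_coord|exact: measurable_cst].
Qed.

Hypothesis X_exp : exponential_noise X.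

Definition tail (b : option R) : R :=
  if b is Some c then expR (- Num.max c 0) else 1.

Lemma half_line_prob i b : P (X i @^-1` half_line b) = (tail b)%:E.
Proof.
case: b => [c|] /=; last by rewrite preimage_setT probability_setT.
by have /= := @exponential_tail R (distribution P (X i)) (X_exp.2 i) c.
Qed.

Lemma cylinder_prob b :
  P (sample @^-1` cylinder b) = (\prod_i tail (b i))%:E.
Proof.
rewrite (_ : _ @^-1` _ = \bigcap_i (X i @^-1` half_line (b i))); last first.
  by apply/seteqP; split=> w h i; [move=> _|]; apply: h.
rewrite X_exp.1 => [|i]; last exact: measurable_half_line.
by rewrite -prodEFin; apply: eq_bigr => i _; exact: half_line_prob.
Qed.

(* Both sides are finite measures of E, and they agree on the pi-system of the
   cylinders, which generates the sigma-algebra. *)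
Lemma memoryless i c (E : set noise_space) : 0 <= c -> measurable E ->
  P (sample @^-1` (shift i c @^-1` E) `&` X i @^-1` `]c, +oo[) =
  ((expR (- c))%:E * P (sample @^-1` E))%E.
Proof.
move=> c0 mE.
have mXi : measurable (X i @^-1` `]c, +oo[).
  by rewrite -[X in measurable X]setTI; exact: measurable_funPT.
pose m1 : {measure set noise_space -> \bar R} :=
  measure_function_pushforward__canonical__measure_function_Measure
    (mrestr P mXi) (measurableT_comp (measurable_shift i c) measurable_sample).
pose k : {nonneg R} := NngNum (expR_ge0 (- c)).
pose m2 : {measure set noise_space -> \bar R} :=
  mscale k (measure_function_pushforward__canonical__measure_function_Measure
    P measurable_sample).
apply: (@measure_unique _ R noise_space cylinders (fun=> setT) _ _ _ _ m1 m2) => //.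
- exact: cylinders_setI.
- by move=> _; exists (fun=> None) => //; apply/seteqP; split.
- by rewrite bigcup_const.
- move=> _ [b _ <-].
  (* On coordinate [i] the constraints [u < x i - c] and [c < x i] merge into a single half-line. *)
  pose b' j := if j == i then Some (if b i is Some u then Num.max (u + c) c else c)
               else b j.
  transitivity (P (sample @^-1` cylinder b')).
    congr (P _); apply/seteqP; split=> w /=.
      move=> [h hi] j; rewrite /b'; case: eqP => [->|/eqP/negbTE ji].
        move: (h i) hi; rewrite /sample /shift /= eqxx mul1r.
        case: (b i) => [u|] //=; rewrite !in_itv /= !andbT gt_max.
        by rewrite ltrBrDr => -> ->.
      by move: (h j); rewrite /sample /shift /= ji mul0r subr0.
    move=> h; split=> [j|]; last first.
      move: (h i); rewrite /b' eqxx /sample /=.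
      by case: (b i) => [u|] //=; rewrite !in_itv /= !andbT gt_max => /andP[].
    move: (h j); rewrite /b' /sample /shift; case: eqP => [->|_]; last by rewrite mul0r subr0.
    rewrite mul1r; case: (b i) => [u|] //=.
    by rewrite !in_itv /= !andbT gt_max ltrBrDr => /andP[].
  rewrite cylinder_prob /m2 /= /mscale /= /pushforward cylinder_prob -EFinM.
  congr EFin; rewrite (bigD1 i) //= [in RHS](bigD1 i) //= mulrA; congr (_ * _).
    rewrite /b' eqxx /=; case: (b i) => [u|] /=; last by rewrite mulr1 max_l.
    rewrite -expRD; congr expR.
    (* In both cases [max (u + c) c = max u 0 + c], which is nonnegative since [0 <= c]. *)
    have [u0|u0] := leP u 0.
      by rewrite subr0 [Num.max (u + c) c]max_r ?max_l //; lra.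
    by rewrite [Num.max (u + c) c]max_l ?max_l; lra.
  by apply: eq_bigr => j /negbTE ji; rewrite /b' ji.
- move=> _; rewrite /m1 /= /pushforward /mrestr.
  by rewrite preimage_setT setTI (le_lt_trans (probability_le1 P mXi)) ?ltry.
Qed.

End Memoryless.

(** * Follow the perturbed leader *)

Section Leader.
Variables (R : realType) (I : finType) (i0 : I) (loss : nat -> I -> R) (eta : R).
Implicit Types (x y : I -> R).

Definition score x t i := \sum_(j < t) loss j i - x i / eta.

Definition leader x t := [arg min_(i < i0) score x t i]%O.

Lemma leader_min x t i : score x t (leader x t) <= score x t i.
Proof. by rewrite /leader; case: arg_minP => // j _; apply. Qed.

Lemma leader_unique x t i : (forall j, j != i -> score x t i < score x t j) ->
  leader x t = i.
Proof.
move=> lt; apply/eqP; case: eqVneq => // /lt; rewrite ltNge.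
by rewrite leader_min.
Qed.

(** Induction on [T]: the bound at [T] is applied to the leader at [T.+1], whose score at [T.+1] is
    minimal. The noise enters only once, through the first leader. *)
Lemma be_the_leader x T i :
  \sum_(t < T) loss t (leader x t.+1) - x (leader x 0) / eta <= score x T i.
Proof.
elim: T i => [|T IH] i.
  by have := leader_min x 0 i; rewrite /score !big_ord0.
rewrite big_ord_recr /= addrAC.
apply: le_trans (leader_min x T.+1 i).
have := IH (leader x T.+1).
rewrite /score [in X in _ -> X]big_ord_recr /=; lra.
Qed.

Hypothesis eta_gt0 : 0 < eta.

(* The noise 2 * eta lowers the score of i by 2, which one round of losses cannot
   compensate. With 1 in place of 2, ties could occur, and their resolution by
   arg min would matter. *)
Lemma leader_stable x y t i :
  (forall j, 0 <= loss t j <= 1) ->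
  y i = x i + 2 * eta -> (forall j, j != i -> y j = x j) ->
  leader x t = i -> leader y t = i /\ leader y t.+1 = i.
Proof.
move=> l01 yi yj xi.
have si : score y t i = score x t i - 2.
  by rewrite /score yi mulrDl mulfK ?gt_eqF // opprD addrA.
have sj j : j != i -> score x t i <= score y t j.
  move=> /yj yjE; rewrite (_ : score y t j = score x t j) ?/score ?yjE //.
  by rewrite -xi; exact: leader_min.
have sS j : score y t.+1 j = score y t j + loss t j.
  by rewrite /score big_ord_recr /= addrAC.
split; apply: leader_unique => j /sj; first by rewrite si; lra.
by rewrite !sS si; move: (l01 i) (l01 j) => /andP[? ?] /andP[? ?]; lra.
Qed.

End Leader.

(** * Probability that the leader changes *)

Section SwitchProbability.
Context (R : realType) (I : finType) d (Omega : measurableType d)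
  (P : probability Omega R) (X : I -> {RV P >-> R}).
Variables (i0 : I) (loss : nat -> I -> R) (eta : R).
Hypothesis X_exp : exponential_noise X.
Hypothesis eta_gt0 : 0 < eta.

Let q t w := leader i0 loss eta (sample X w) t.

Lemma measurable_leader t i :
  measurable [set x : noise_space R I | leader i0 loss eta x t = i].
Proof.
apply: measurable_arg_min => j; apply: measurable_funB; first exact: measurable_cst.
by apply: measurable_funM; [exact: measurable_coord|exact: measurable_cst].
Qed.

Lemma measurable_policy t i : measurable (q t @^-1` [set i]).
Proof.
have := @measurable_sample R I _ Omega P X measurableT _ (measurable_leader t i).
by rewrite setTI.
Qed.

Lemma measurable_stay t : measurable [set w | q t.+1 w = q t w].
Proof.
rewrite [X in measurable X](_ : _ =
    \bigcup_(i in setT) (q t.+1 @^-1` [set i] `&` q t @^-1` [set i])); last first.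
  by apply/seteqP; split=> w /= => [e|[i _ [/= -> ->]//]]; exists (q t w).
apply: fin_bigcup_measurable => [|i _]; first exact: finite_finset.
by apply: measurableI; exact: measurable_policy.
Qed.

Lemma switchE t : [set w | q t.+1 w != q t w] = ~` [set w | q t.+1 w = q t w].
Proof. by apply/seteqP; split=> w /= /eqP. Qed.

Lemma measurable_switch t : measurable [set w | q t.+1 w != q t w].
Proof. by rewrite switchE; apply: measurableC; exact: measurable_stay. Qed.

(* i leads at times t and t.+1 as soon as it leads at time t when its noise is
   diminished by 2 * eta. *)
Lemma switch_prob t : (forall i, 0 <= loss t i <= 1) ->
  (P [set w | q t.+1 w != q t w] <= (2 * eta)%:E)%E.
Proof.
move=> l01; have c0 : 0 <= 2 * eta by rewrite mulr_ge0 // ltW.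
rewrite switchE probability_setC; last exact: measurable_stay.
suff : ((expR (- (2 * eta)))%:E <= P [set w | q t.+1 w = q t w])%E.
  move=> /(leeB (lexx 1%E)) /le_trans; apply.
  by rewrite -EFinB lee_fin; have := expR_ge1Dx (- (2 * eta)); lra.
(* Both sides are split by the value [i] of the leader, because the coordinate to be shifted is the
   leader's own. *)
rewrite (measure_fiber_sum P (measurable_stay t) (measurable_policy t)).
rewrite -[leLHS]mule1 -(@probability_setT _ _ _ P).
rewrite (measure_fiber_sum P measurableT (measurable_policy t)).
rewrite ge0_sume_distrr; last by move=> i _; exact: measure_ge0.
apply: lee_sum => i _; rewrite setTI.
have mL := measurable_leader t i.
rewrite -[X in (_ * P X)%E]/(sample X @^-1`
  [set x : noise_space R I | leader i0 loss eta x t = i]).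
rewrite -(memoryless X_exp i c0 mL).
apply: le_measure; rewrite ?inE.
- apply: measurableI.
    have ms := measurableT_comp (measurable_shift i (2 * eta)) (measurable_sample X).
    by have := ms measurableT _ mL; rewrite setTI.
  by rewrite -[X in measurable X]setTI; exact: measurable_funPT.
- by apply: measurableI; [exact: measurable_stay|exact: measurable_policy].
move=> w [/= sh _].
have [] := @leader_stable _ _ i0 loss eta eta_gt0 (shift i (2 * eta) (sample X w))
   (sample X w) t i l01 _ _ sh.
- by rewrite /shift eqxx mul1r subrK.
- by move=> j /negbTE ji; rewrite /shift ji mul0r subr0.
by move=> e1 e2; split; rewrite /= /q ?e1 ?e2.
Qed.

End SwitchProbability.

Section IndicatorBound.
Context d (T : measurableType d) (R : realType) (P : probability T R).

(* Unlike ge0_le_integral, this does not ask for measurability. *)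
Lemma le_integral_of_ge0 (f g : T -> \bar R) :
  (forall t, 0 <= f t <= g t)%E -> (\int[P]_t f t <= \int[P]_t g t)%E.
Proof.
move=> fg.
have f0 t : (0 <= f t)%E by have /andP[] := fg t.
have g0 t : (0 <= g t)%E by have /andP[? ?] := fg t; exact: (le_trans (f0 t)).
rewrite !ge0_integralTE //; apply: le_ereal_sup => _ [h hf <-].
by exists h => // t; apply: le_trans (hf t) _; have /andP[] := fg t.
Qed.

Lemma Rintegral_le_indic (J : finType) (f : T -> R) (c0 : R) (c p : J -> R)
    (B : J -> set T) :
  (forall j, measurable (B j)) -> 0 <= c0 -> (forall j, 0 <= c j) ->
  (forall j, (P (B j) <= (p j)%:E)%E) ->
  (forall t, 0 <= f t <= c0 + \sum_j c j * \1_(B j) t) ->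
  \int[P]_t f t <= c0 + \sum_j c j * p j.
Proof.
move=> mB c00 c_ge0 Bp fle.
have f0 : (0 <= \int[P]_t (f t)%:E)%E.
  by apply: integral_ge0 => t _; rewrite lee_fin; have /andP[] := fle t.
(* The extended bound also gives finiteness, without which [fine] would not reflect the integral. *)
suff le : (\int[P]_t (f t)%:E <= (c0 + \sum_j c j * p j)%:E)%E.
  rewrite /Rintegral -lee_fin fineK // ge0_fin_numE //.
  exact: le_lt_trans le (ltry _).
apply: (@le_trans _ _ (\int[P]_t (c0%:E + \sum_j (c j)%:E * (\1_(B j) t)%:E))%E).
  apply: le_integral_of_ge0 => t; rewrite lee_fin.
  have /andP[-> /=] := fle t; rewrite -lee_fin => /le_trans; apply.
  by rewrite EFinD -sumEFin.
have mI j : measurable_fun setT (fun t => ((c j)%:E * (\1_(B j) t)%:E)%E).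
  by apply: measurable_funeM; apply/measurable_EFinP; exact: measurable_indic.
have I0 j t : (0 <= (c j)%:E * (\1_(B j) t)%:E)%E by rewrite mule_ge0 ?lee_fin.
rewrite ge0_integralD //; last 2 first.
- by move=> t _; apply: sume_ge0 => j _.
- exact: emeasurable_sum.
rewrite integral_cst //= [X in (_ * X + _)%E](@probability_setT _ _ _ P).
rewrite mule1 EFinD leeD2l //.
rewrite ge0_integral_sum // -sumEFin; apply: lee_sum => j _.
rewrite ge0_integralZl ?lee_fin //; last first.
  by apply/measurable_EFinP; exact: measurable_indic.
rewrite integral_indic // setIT EFinM; apply: lee_wpmul2l; last exact: Bp.
by rewrite lee_fin.
Qed.

End IndicatorBound.

(** * Expected loss and switching cost of the leaders *)

Section ExpectedLeaderLoss.
Context (R : realType) (I : finType) d (Omega : measurableType d)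
  (P : probability Omega R) (X : I -> {RV P >-> R}).
Hypothesis X_exp : exponential_noise X.
Variables (i0 : I) (loss : nat -> I -> R) (T : nat).
Hypothesis loss01 : forall t i, (t < T)%N -> 0 <= loss t i <= 1.
Hypotheses (T_gt0 : (0 < T)%N) (I_gt1 : (1 < #|I|)%N).

(** A discrete layer-cake formula: above [m], the size of [y] is counted by the integer levels it
    exceeds, and the cap limits the count to [k] levels. *)
Lemma min_le_count (y : R) m k : Num.min (m + k)%:R y <=
  m%:R + \sum_(n < k) ((m + n)%:R < y)%R%:R.
Proof.
elim: k => [|k IH]; first by rewrite big_ord0 !addr0 addn0 ge_min lexx.
rewrite big_ord_recr /= addrA addnS -natr1.
apply: le_trans (lerD IH (lexx _)).
rewrite ge_min; case: ltP => /= h; first by rewrite lexx.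
by rewrite addr0 lexx orbT.
Qed.

Lemma expRN_sum_le m k :
  \sum_(n < k) expR (- (m + n)%:R) <= 2 * expR (- m%:R) :> R.
Proof.
(* Keeping the subtracted term closes the induction, as the ratio [expR (-1)] is at most [1 / 2]. *)
suff : \sum_(n < k) expR (- (m + n)%:R) <=
    2 * (expR (- m%:R) - expR (- (m + k)%:R)) :> R.
  by have := expR_gt0 (- (m + k)%:R : R); lra.
elim: k => [|k IH]; first by rewrite big_ord0 addn0 subrr mulr0.
rewrite big_ord_recr /= addnS -[(m + k).+1%:R]natr1 opprD expRD.
have e2 : expR (-1) <= 1 / 2 :> R.
  rewrite expRN mul1r lef_pV2 ?posrE ?expR_gt0 //.
  by have := expR_ge1Dx (1 : R); lra.
have := expR_gt0 (- (m + k)%:R : R) => e0.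
have := ler_wpM2l (ltW e0) e2; lra.
Qed.

(** Amounts to [expR (1 / 2) <= 2], which follows from [expR (- (1 / 2)) >= 1 / 2]. It later bounds
    [eta^-1] by [2 * eta * T]. *)
Lemma ln2_ge : 1 / 2 <= ln 2 :> R.
Proof.
rewrite -[leLHS]expRK ler_ln ?posrE ?expR_gt0 //.
have e := expR_ge1Dx (- (1 / 2) : R).
have := expR_gt0 (1 / 2 : R) => p.
have : expR (1 / 2) * expR (- (1 / 2)) = 1 :> R by rewrite -expRD subrr expR0.
have := ler_wpM2l (ltW p) e; lra.
Qed.

Lemma indic_preimage_itv (f : Omega -> R) (i : interval R) w :
  \1_(f @^-1` [set` i]) w = (f w \in i)%:R :> R.
Proof.
by rewrite indicE; congr (nat_of_bool _)%:R; apply/idP/idP => [/set_mem|/mem_set].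
Qed.

Let eta : R := Num.sqrt (ln #|I|%:R / T%:R).
Let q t w := leader i0 loss eta (sample X w) t.

Let lnI_ge : 1 / 2 <= ln #|I|%:R :> R.
Proof.
apply: le_trans ln2_ge _.
by rewrite ler_ln ?posrE ?ltr0n ?ler_nat // ltnW.
Qed.

Let lnI_gt0 : 0 < ln #|I|%:R :> R.
Proof. by apply: lt_le_trans lnI_ge; rewrite divr_gt0. Qed.

Lemma eta_gt0 : 0 < eta.
Proof. by rewrite sqrtr_gt0 divr_gt0 ?ltr0n. Qed.

Lemma eta_sqr : eta ^+ 2 * T%:R = ln #|I|%:R.
Proof.
have T0 : T%:R != 0 :> R by rewrite pnatr_eq0 -lt0n.
by rewrite sqr_sqrtr ?mulfVK // divr_ge0 ?ler0n // ltW.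
Qed.

Lemma etaM_T : eta * T%:R = Num.sqrt (T%:R * ln #|I|%:R).
Proof.
rewrite -[LHS]ger0_norm ?mulr_ge0 ?ler0n ?(ltW eta_gt0) // -sqrtr_sqr.
by congr Num.sqrt; rewrite -eta_sqr exprMn; ring.
Qed.

(* The be-the-leader bound capped at T: as the minimum of T and of the largest
   noise is at most m plus a finite number of indicators, no integral of an
   unbounded function occurs. *)
Lemma leader_loss_le i w m k : eta * T%:R <= (m + k)%:R ->
  \sum_(t < T) loss t (q t.+1 w) <= \sum_(t < T) loss t i + m%:R / eta +
    (T%:R * \sum_j (X j w < 0)%R%:R +
     eta^-1 * \sum_(n < k) \sum_j ((m + n)%:R < X j w)%R%:R).
Proof.
move=> mk; have e0 := eta_gt0.
have sum_leT (r : nat -> I) : \sum_(t < T) loss t (r t) <= T%:R.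
  rewrite -[X in X%:R]card_ord -sumr_const; apply: ler_sum => t _.
  by have /andP[] := loss01 (r t) (ltn_ord t).
have sum_ge0 : 0 <= \sum_(t < T) loss t i.
  by apply: sumr_ge0 => t _; have /andP[] := loss01 i (ltn_ord t).
have ct0 : 0 <= \sum_(n < k) \sum_j ((m + n)%:R < X j w)%R%:R :> R.
  by apply: sumr_ge0 => n _; apply: sumr_ge0 => j _; exact: ler0n.
have ng0 (J : pred I) : 0 <= \sum_(j | J j) (X j w < 0)%R%:R :> R.
  by apply: sumr_ge0 => j _; exact: ler0n.
have m0 : 0 <= m%:R / eta by rewrite divr_ge0 ?ler0n // ltW.
(* A negative noise of the comparator has probability zero; the term with factor [T] then pays for
   the whole loss. *)
have [Xi|Xi] := ltP (X i w) 0.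
  apply: le_trans (sum_leT (fun t => q t.+1 w)) _.
  have : 1 <= \sum_j (X j w < 0)%R%:R :> R.
    by rewrite (bigD1 i) //= Xi lerDl.
  move=> /(ler_wpM2l (ler0n R T)).
  have : 0 <= eta^-1 * \sum_(n < k) \sum_j ((m + n)%:R < X j w)%R%:R.
    by rewrite mulr_ge0 // invr_ge0 ltW.
  lra.
set y := X (q 0%N w) w.
have cap : Num.min T%:R (y / eta) <= m%:R / eta +
    eta^-1 * \sum_(n < k) \sum_j ((m + n)%:R < X j w)%R%:R.
  have -> : Num.min T%:R (y / eta) = eta^-1 * Num.min (eta * T%:R) y.
    by rewrite minr_pMr ?invr_ge0 ?(ltW e0) // mulKf ?gt_eqF // [y / _]mulrC.
  rewrite [m%:R / _]mulrC -mulrDr ler_wpM2l ?invr_ge0 ?(ltW e0) //.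
  apply: (@le_trans _ _ (Num.min (m + k)%:R y)).
    by rewrite le_min !ge_min mk lexx orbT.
  apply: le_trans (min_le_count y m k) _; rewrite lerD2l; apply: ler_sum => n _.
  by rewrite (bigD1 (q 0%N w)) //= -/y lerDl; apply: sumr_ge0 => j _; exact: ler0n.
have lead : \sum_(t < T) loss t (q t.+1 w) <= \sum_(t < T) loss t i + y / eta.
  have btl : \sum_(t < T) loss t (q t.+1 w) - y / eta <=
      \sum_(t < T) loss t i - X i w / eta.
    exact: be_the_leader.
  have : 0 <= X i w / eta by rewrite divr_ge0 // ltW.
  lra.
have : \sum_(t < T) loss t (q t.+1 w) <=
    \sum_(t < T) loss t i + Num.min T%:R (y / eta).
  rewrite addr_minr le_min lead andbT.
  by apply: le_trans (sum_leT (fun t => q t.+1 w)) _; rewrite lerDr.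
have : 0 <= T%:R * \sum_j (X j w < 0)%R%:R :> R by rewrite mulr_ge0 ?ler0n.
lra.
Qed.

Lemma expected_leader_loss (f : Omega -> R) (c : R) (i : I) : 0 <= c ->
  (forall w, 0 <= f w <= \sum_(t < T) loss t (q t w) +
                         c * \sum_(t < T) (q t.+1 w != q t w)%:R) ->
  \int[P]_w f w <= \sum_(t < T) loss t i +
                   (9 + 2 * c) * Num.sqrt (T%:R * ln #|I|%:R).
Proof.
move=> c0 fle; have e0 := eta_gt0.
(* As [m] exceeds [ln #|I|], the union bound [#|I| * expR (- m)] is at most 1; [k] lifts the last
   level above the cap [eta * T]. *)
set m := (Num.truncn (ln #|I|%:R : R)).+1.
set k := (Num.truncn (eta * T%:R)).+1.
have mk : eta * T%:R <= (m + k)%:R.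
  by apply: le_trans (ltW (truncnS_gt _)) _; rewrite ler_nat leq_addl.
(* Three families of events: negative noises, noises above level [m + n], and switches. In [c + 1],
   the 1 pays for replacing the leader at [t] by the leader at [t.+1]. *)
pose cf (j : I + 'I_k * I + 'I_T) : R := match j with
  | inl (inl _) => T%:R | inl (inr _) => eta^-1 | inr _ => c + 1 end.
pose p (j : I + 'I_k * I + 'I_T) : R := match j with
  | inl (inl _) => 0 | inl (inr (n, _)) => expR (- (m + n)%:R) | inr _ => 2 * eta end.
pose B (j : I + 'I_k * I + 'I_T) : set Omega := match j with
  | inl (inl j) => X j @^-1` `]-oo, 0[
  | inl (inr (n, j)) => X j @^-1` `](m + n)%:R, +oo[
  | inr t => [set w | q t.+1 w != q t w] end.
have sum_ge0 : 0 <= \sum_(t < T) loss t i.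
  by apply: sumr_ge0 => t _; have /andP[] := loss01 i (ltn_ord t).
apply: (@le_trans _ _ (\sum_(t < T) loss t i + m%:R / eta + \sum_j cf j * p j)).
  apply: (@Rintegral_le_indic _ _ _ P _ f _ cf p B).
  - move=> [[j|[n j]]|t] /=; last exact: measurable_switch.
      by rewrite -[X in measurable X]setTI; exact: measurable_funPT.
    by rewrite -[X in measurable X]setTI; exact: measurable_funPT.
  - by rewrite addr_ge0 // divr_ge0 ?ler0n // ltW.
  - by move=> [[j|[n j]]|t] /=; rewrite ?ler0n ?invr_ge0 ?(ltW e0) ?addr_ge0.
  - move=> [[j|[n j]]|t] /=.
    + have h : P (X j @^-1` `]-oo, 0[) = 0%E.
        exact: (@exponential_negative R (distribution P (X j)) (X_exp.2 j)).
      by rewrite h.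
    + have h : P (X j @^-1` `](m + n)%:R, +oo[) = (expR (- (m + n)%:R))%:E.
        rewrite -[in RHS](@max_l _ _ (m + n)%:R 0) //.
        exact: (half_line_prob X_exp j (Some _)).
      by rewrite h.
    + by apply: switch_prob => // j; exact: loss01.
  move=> w; have /andP[-> /= fw] := fle w; apply: le_trans fw _.
  have sw : \sum_(t < T) loss t (q t w) <= \sum_(t < T) loss t (q t.+1 w) +
      \sum_(t < T) (q t.+1 w != q t w)%:R.
    rewrite -big_split /=; apply: ler_sum => t _.
    case: eqVneq => [->|_]; first by rewrite addr0.
    have /andP[_ h1] := loss01 (q t w) (ltn_ord t).
    have /andP[h2 _] := loss01 (q t.+1 w) (ltn_ord t).
    by apply: le_trans h1 _; rewrite lerDr.
  have lead := leader_loss_le i w mk.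
  rewrite !big_sumType /= -!mulr_sumr.
  have -> : \sum_(j : I) \1_(B (inl (inl j))) w = \sum_j (X j w < 0)%R%:R :> R.
    by apply: eq_bigr => j _; rewrite /= indic_preimage_itv in_itv.
  have -> : \sum_(nj : 'I_k * I) \1_(B (inl (inr nj))) w =
      \sum_(n < k) \sum_j ((m + n)%:R < X j w)%R%:R :> R.
    rewrite pair_big /=; apply: eq_bigr => -[n j] _ /=.
    by rewrite indic_preimage_itv in_itv /= andbT.
  have -> : \sum_(t < T) \1_(B (inr t)) w = \sum_(t < T) (q t.+1 w != q t w)%:R :> R.
    apply: eq_bigr => t _; rewrite /= indicE; congr (nat_of_bool _)%:R.
    by apply/idP/idP => [/set_mem|/mem_set].
  lra.
(* In units of [Q], the level [m] costs 3, the levels above it 4 and the switches [2 * (c + 1)], in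
   total [9 + 2 * c]. *)
rewrite -addrA lerD2l !big_sumType /= -etaM_T.
set Q := eta * T%:R.
have lnE : eta * Q = ln #|I|%:R by rewrite /Q mulrA -expr2 eta_sqr.
have Q0 : 0 <= Q by rewrite mulr_ge0 ?ler0n ?ltW.
have eQ : eta^-1 <= 2 * Q.
  rewrite -[leLHS]mul1r ler_pdivrMr // -mulrA [Q * _]mulrC lnE.
  by have := lnI_ge; lra.
have m_le : m%:R / eta <= 3 * Q.
  apply: (@le_trans _ _ ((eta * Q + 1) / eta)).
    rewrite ler_wpM2r ?invr_ge0 ?(ltW e0) // /m -natr1 lerD2r lnE.
    by rewrite truncn_le ltW.
  by rewrite mulrDl mul1r [eta * Q]mulrC mulfK ?gt_eqF //; lra.
have tail_le : \sum_(nj : 'I_k * I) eta^-1 * p (inl (inr nj)) <= 4 * Q.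
  rewrite -mulr_sumr.
  have -> : \sum_(nj : 'I_k * I) p (inl (inr nj)) =
      \sum_(n < k) \sum_(j : I) expR (- (m + n)%:R) :> R.
    by rewrite pair_big /=; apply: eq_bigr => -[].
  under eq_bigr do rewrite sumr_const -[expR _ *+ _]mulr_natl.
  rewrite -mulr_sumr.
  have Nm : #|I|%:R * expR (- m%:R) <= 1 :> R.
    have N0 : 0 < #|I|%:R :> R by rewrite ltr0n ltnW.
    rewrite mulrC -ler_pdivlMr // mul1r -[leRHS]lnK ?posrE ?invr_gt0 //.
    by rewrite ler_expR lnV ?posrE // lerN2 ltW // truncnS_gt.
  have := ler_wpM2l (ler0n R #|I|) (expRN_sum_le m k) => h1.
  have i0' : 0 <= eta^-1 by rewrite invr_ge0 ltW.
  apply: (@le_trans _ _ (eta^-1 * 2)); last lra.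
  by rewrite ler_wpM2l //; lra.
rewrite big1 => [|j _]; last by rewrite mulr0.
rewrite sumr_const card_ord -[_ *+ T]mulr_natl.
have -> : T%:R * ((c + 1) * (2 * eta)) = 2 * (c + 1) * Q by rewrite /Q; ring.
lra.
Qed.

End ExpectedLeaderLoss.

Lemma detpolicy_singleton (S A : finType) (pi pi' : detpolicy S A) :
  (#|A| <= 1)%N -> pi = pi'.
Proof. by move=> /fintype_le1P A1; apply/ffunP => s; exact: A1. Qed.

Theorem theorem5p9 (R : realType) :
  exists C : R, forall (S A : finType) (M : mdp R S A) (sstar : S) (a : A),
    (1 < #|S|)%N -> communicating M -> M sstar a sstar = 1 ->
    (exists (l : nat) (catch : S -> nspolicy R S A), catching M sstar l catch) /\
    forall (l : nat) (catch : S -> nspolicy R S A) (goto : policy R S A)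
      (d1 : fdist R S) (T : nat) (ell : nat -> S -> A -> R)
      (d : measure_display) (Omega : measurableType d)
      (P : probability Omega R) (X : detpolicy S A -> {RV P >-> R}),
      catching M sstar l catch ->
      best_policy_to M sstar goto ->
      (forall (t : nat) (s : S) (b : A), (t < T)%N -> 0 <= ell t s b <= 1) ->
      exponential_noise X ->
      regret M d1 T ell sstar a goto l catch X
        <= C * diam M ^+ 2 * Num.sqrt (T%:R * #|S|%:R * ln #|A|%:R).
Proof.
(* [35 = 9 + 2 * 13]: a switch costs [c = 13 * D ^ 2], and the 9 is absorbed by [D ^ 2 >= 1]. *)
exists 35 => S A M sstar a S_gt1 comM loop; split.
  exact: exists_catching loop S_gt1 comM.
move=> l catch goto d1 T ell d Omega P X catchM bestM ell01 X_exp.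
have D1 := diam_ge1 S_gt1 comM; set D := diam M in D1 *.
set B := (X in _ <= X).
have B0 : 0 <= B.
  by apply: mulr_ge0; [apply: mulr_ge0; rewrite ?sqr_ge0|exact: sqrtr_ge0].
pose q w := fpl M d1 T ell a (fun pi => X pi w).
pose f w := learner_loss M d1 T ell sstar goto l catch (q w).
have f0 w : 0 <= f w.
  apply: learner_loss_ge0 => //.
  exact: min_catch_prob_gt0 catchM.
have fle w : f w <= \sum_(t < T) hat_loss M d1 ell t (q w t) +
    13 * D ^+ 2 * \sum_(t < T) (q w t.+1 != q w t)%:R.
  exact: learner_loss_switches.
suff bound pi : \int[P]_w f w <= policy_loss M d1 T ell pi + B.
  rewrite /regret lerBlDr -lerBlDl; apply: lb_le_inf.
    by exists (policy_loss M d1 T ell [ffun=> a]); exists [ffun=> a].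
  by move=> _ [pi _ <-]; rewrite lerBlDl addrC.
(* Covers [T = 0] and a single action, where [fpl_rate] is 0 and the FPL analysis does not apply.
   The leader is constant, so the bound holds with an empty family of events. *)
have base : (forall w t, (t < T)%N -> q w t = pi) ->
    (forall w t, (t < T)%N -> q w t.+1 = q w t) ->
    \int[P]_w f w <= policy_loss M d1 T ell pi + B.
  move=> qpi qS; apply: (@le_trans _ _ (policy_loss M d1 T ell pi)); last by rewrite lerDl.
  have pl0 : 0 <= policy_loss M d1 T ell pi.
    by apply: sumr_ge0 => t _; exact: (hat_loss_ge0 M d1 ell01 pi (ltn_ord t)).
  have := @Rintegral_le_indic _ _ _ P void f _ (fun=> 0) (fun=> 0) (fun=> set0) _ pl0.
  rewrite big1 ?addr0 //; apply=> [[]|[]|[]|w]; rewrite f0 big1 ?addr0 //=.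
  apply: le_trans (fle w) _; rewrite [X in _ * X]big1 ?mulr0 ?addr0.
    rewrite le_eqVlt; apply/orP; left; apply/eqP.
    by apply: eq_bigr => t _; rewrite qpi.
  by move=> t _; rewrite qS // eqxx.
have [T0|T_gt0] := posnP T.
  by apply: base => w t; rewrite T0.
have [A1|A_gt1] := leqP #|A| 1.
  by apply: base => w t _; exact: detpolicy_singleton.
have N_gt1 : (1 < #|{: detpolicy S A}|)%N.
  rewrite card_ffun; apply: (leq_trans A_gt1).
  by rewrite -[X in (X <= _)%N]expn1; apply: leq_pexp2l; exact: ltnW.
have lossE t pi' : (t < T)%N -> 0 <= hat_loss M d1 ell t pi' <= 1.
  move=> tT; apply/andP; split; first exact: (hat_loss_ge0 M d1 ell01).
  exact: (hat_loss_le1 M d1 ell01).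
have := @expected_leader_loss _ _ _ _ P X X_exp [ffun=> a] (hat_loss M d1 ell) T
  lossE T_gt0 N_gt1 f (13 * D ^+ 2) pi.
rewrite -/(policy_loss M d1 T ell pi) => h.
apply: (le_trans (h _ _)) => {h}; first by rewrite mulr_ge0 ?sqr_ge0.
  by move=> w; rewrite f0 fle.
rewrite lerD2l /B card_ffun natrX lnXn ?ltr0n ?(ltn_trans _ A_gt1) //.
rewrite -[_ *+ #|S|]mulr_natl [T%:R * (_ * _)]mulrA.
apply: ler_wpM2r; first exact: sqrtr_ge0.
have : 1 <= D ^+ 2 by rewrite exprn_ege1.
lra.
Qed.
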